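(* Let $p\ge 2$ be an even integer and $A>0$. Suppose $h=f+ig\in L^2(\mathbb{R},\mathbb{C})$ (with $f,g$ real-valued) is supported on $[-A,A]$, and let $t_0=\frac{(p-2)A}{4}$. Then $N_t h=N_{t_0}h$ for every $t\ge t_0$.
   Context: For $h\in L^1(\mathbb{R},\mathbb{C})\cap L^2(\mathbb{R},\mathbb{C})$ put $h_+(x)=h(x)\chi_{\{x>0\}}$, $h_-(x)=h(x)\chi_{\{x<0\}}$, and for $t\ge 0$ let $S_t h(x)=h_+(x-t)+h_-(x+t)$. The Fourier transform is $\hat h(y)=\int_{\mathbb{R}} e^{-2\pi i x y}h(x)\,dx$, and $N_t h=\|\widehat{S_t h}\|_{L^p(\mathbb{R})}=\left(\int_{\mathbb{R}}|\widehat{S_th}(y)|^p\,dy\right)^{1/p}$. *)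

(* Defs.v *)
From HB Require Import structures.
From mathcomp Require Import all_boot all_order all_algebra.
From mathcomp Require Import all_classical all_reals all_analysis.
From mathcomp Require Export complex.

Set Implicit Arguments.
Unset Strict Implicit.
Unset Printing Implicit Defensive.

Import Order.TTheory GRing.Theory Num.Theory.
Import numFieldNormedType.Exports.

Local Open Scope classical_set_scope.
Local Open Scope ring_scope.
Local Open Scope complex_scope.

Section ComplexFunctions.
Context {R : realType}.
Local Notation mu := (@lebesgue_measure R).
Local Notation normc := ComplexField.Normc.normc.

(* Values are extended reals, so the definition needs no finiteness proof. *)
Definition cLnorm (p : \bar R) (h : R -> R[i]) : \bar R :=
  Lnorm mu p (fun x => (normc (h x))%:E).

(* Functions, not classes modulo a.e. equality; measurable means Borel. *)
Definition in_cLfun (p : \bar R) (h : R -> R[i]) : Prop :=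
  [/\ measurable_fun [set: R] (fun x => complex.Re (h x)),
      measurable_fun [set: R] (fun x => complex.Im (h x)) &
      (cLnorm p h < +oo)%E].

(* Like [Rintegral], only meaningful for integrable [h]. *)
Definition cintegral (h : R -> R[i]) : R[i] :=
  (\int[mu]_x complex.Re (h x)) +i* (\int[mu]_x complex.Im (h x)).

(* e^{i theta} *)
Definition expi (theta : R) : R[i] := cos theta +i* sin theta.

Definition fourier (h : R -> R[i]) (y : R) : R[i] :=
  cintegral (fun x => expi (- (2 * pi * x * y)) * h x).

Definition pos_part (h : R -> R[i]) (x : R) : R[i] := if 0 < x then h x else 0.

Definition neg_part (h : R -> R[i]) (x : R) : R[i] := if x < 0 then h x else 0.

Definition split_shift (t : R) (h : R -> R[i]) (x : R) : R[i] :=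
  pos_part h (x - t) + neg_part h (x + t).

Definition split_norm (p : \bar R) (t : R) (h : R -> R[i]) : \bar R :=
  cLnorm p (fourier (split_shift t h)).

(* Almost everywhere, as befits a class in L^2. *)
Definition supported_on (D : set R) (h : R -> R[i]) : Prop :=
  {ae mu, forall x, ~ D x -> h x = 0}.

End ComplexFunctions.

(* Main.v *)
Require Import Defs.
From mathcomp Require Import all_boot all_order all_algebra.
From mathcomp Require Import all_classical all_reals all_analysis.
From mathcomp Require Import complex.
From mathcomp Require Import measurable_realfun.
From mathcomp Require Import ring lra.
Import Order.TTheory GRing.Theory Num.Theory.
Import numFieldNormedType.Exports.
Local Open Scope classical_set_scope.
Local Open Scope ring_scope.
Local Open Scope complex_scope.
Set Implicit Arguments.
Unset Strict Implicit.
Unset Printing Implicit Defensive.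

(** Why the norm stabilises.  Let [a] and [b] be the Fourier transforms of the
    parts of [h] on [x > 0] and [x < 0].  Translation becomes modulation, so the
    transform of [split_shift t h] is [F t = e_t a + e_(-t) b], where
    [e_s y = exp (- 2 i pi s y)].  With [p = 2 m], expand
    [|F t|^p = F t ^ m * conj (F t) ^ m] into products
    [X_j * conj X_k], where [X_j] is the binomial term
    [C(m, j) (e_t a)^(m - j) (e_(-t) b)^j].  The terms with [j = k] do not depend
    on [t].  For [j <> k], put [d = |k - j|]: up to sign, the product has its
    spectrum in the interval from [2 t d - (m - d) A] to [2 t d + (m + d) A], which
    lies to the right of 0 as soon as [(m - 1) A / 2 < t] (the case [d = 1] is the
    worst one).  A function whose
    spectrum avoids 0 has integral 0, so [|F t|^p] has the same integral for all
    [t > t0 = (m - 1) A / 2].  The endpoint [t0] follows by dominated convergence.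

    Convolutions and Fourier inversion are avoided by a dual description of the
    spectrum.  [band a b v] says that pairing [v] with an integrable test function
    [psi] only sees the values of the transform of [psi] on [[a, b]]; this
    property is closed under products, the intervals being added ([bandM]), and
    for a Fourier transform it is the multiplication formula
    ([fourier_mul_fourier], [band_fourier]).  Integrals over the line are taken as
    limits of the means against the Abel kernel [exp (- l |y|)], whose transform
    is the explicit Poisson kernel ([fourier_abel]).  That kernel tends to 0
    uniformly away from the origin ([abel_null_band]) and has total mass 1; the
    latter, with Schur's test, gives the Bessel inequality that puts [a] and [b]
    in L^2 ([integrable_fourier_sqr]).  As [a] and [b] are also bounded, all the
    powers [|F t|^p] are integrable with a common integrable bound. *)

Local Notation normc := ComplexField.Normc.normc.
Local Notation Re := complex.Re.
Local Notation Im := complex.Im.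
Local Notation mu := (@lebesgue_measure _).

(** * Complex numbers and measurable complex functions *)

Section ComplexNumbers.
Context {R : realType}.
Implicit Types (x y z : R[i]) (s t : R).

Lemma ReD x y : Re (x + y) = Re x + Re y.
Proof. by case: x => a b; case: y. Qed.

Lemma ImD x y : Im (x + y) = Im x + Im y.
Proof. by case: x => a b; case: y. Qed.

Lemma ReM x y : Re (x * y) = Re x * Re y - Im x * Im y.
Proof. by case: x => a b; case: y. Qed.

Lemma ImM x y : Im (x * y) = Re x * Im y + Im x * Re y.
Proof. by case: x => a b; case: y. Qed.

Lemma ReJ z : Re (conjc z) = Re z.
Proof. by case: z. Qed.

Lemma ImJ z : Im (conjc z) = - Im z.
Proof. by case: z. Qed.

Lemma complex_ext x y : Re x = Re y -> Im x = Im y -> x = y.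
Proof. by case: x => a b; case: y => c d /= -> ->. Qed.

Lemma normcE2 z : normc z ^+ 2 = Re z ^+ 2 + Im z ^+ 2.
Proof. by case: z => a b /=; rewrite sqr_sqrtr// addr_ge0// sqr_ge0. Qed.

Lemma normc_ge0 z : 0 <= normc z.
Proof. by case: z => a b /=; rewrite sqrtr_ge0. Qed.

Lemma normc_mulJ z : z * conjc z = (normc z ^+ 2)%:C.
Proof. by apply: complex_ext; rewrite ?normcE2 ?ReM ?ImM ReJ ImJ /=; ring. Qed.

Lemma ler_normcD x y : normc (x + y) <= normc x + normc y.
Proof.
by have := ler_normD x y; rewrite !normc_def -raddfD /= lecR; case: x; case: y.
Qed.

Lemma ler_Re_normc z : `|Re z| <= normc z.
Proof.
by rewrite -ler_sqr ?nnegrE ?normc_ge0// real_normK ?num_real// normcE2 lerDl sqr_ge0.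
Qed.

Lemma ler_Im_normc z : `|Im z| <= normc z.
Proof.
by rewrite -ler_sqr ?nnegrE ?normc_ge0// real_normK ?num_real// normcE2 lerDr sqr_ge0.
Qed.

Lemma normc_conj z : normc (conjc z) = normc z.
Proof. by case: z => a b /=; rewrite sqrrN. Qed.

Lemma conjcM x y : conjc (x * y) = conjc x * conjc y.
Proof. exact: rmorphM. Qed.

Lemma normcR s : normc s%:C = `|s|.
Proof. by rewrite /= expr0n addr0 sqrtr_sqr. Qed.

Lemma normcX z n : normc (z ^+ n) = normc z ^+ n.
Proof.
elim: n => [|n IH]; first by rewrite !expr0 ComplexField.Normc.normc1.
by rewrite !exprS ComplexField.Normc.normcM IH.
Qed.

Lemma expi0 : expi (0 : R) = 1.
Proof. by rewrite /expi cos0 sin0. Qed.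

Lemma expiD s t : expi (s + t) = expi s * expi t.
Proof.
by apply: complex_ext; rewrite ?ReM ?ImM /= ?cosD ?sinD//; ring.
Qed.

Lemma expiJ s : conjc (expi s) = expi (- s).
Proof. by rewrite /expi cosN sinN. Qed.

Lemma normc_expi s : normc (expi s) = 1.
Proof. by rewrite /expi /= cos2Dsin2 sqrtr1. Qed.

End ComplexNumbers.

Section ComplexMeasurable.
Context {R : realType} d (T : measurableType d).
Implicit Types u v : T -> R[i].

(** Borel measurability into the plane, read off the two coordinates. *)
Definition cmeasurable u :=
  measurable_fun [set: T] (fun x => Re (u x)) /\
  measurable_fun [set: T] (fun x => Im (u x)).

Lemma cmeasurable_cst (z : R[i]) : cmeasurable (fun=> z).
Proof. by split; exact: measurable_cst. Qed.

Lemma cmeasurableD u v : cmeasurable u -> cmeasurable v ->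
  cmeasurable (fun x => u x + v x).
Proof.
move=> [u1 u2] [v1 v2]; split.
  by under eq_fun do rewrite ReD; exact: measurable_funD.
by under eq_fun do rewrite ImD; exact: measurable_funD.
Qed.

Lemma cmeasurableM u v : cmeasurable u -> cmeasurable v ->
  cmeasurable (fun x => u x * v x).
Proof.
move=> [u1 u2] [v1 v2]; split.
  under eq_fun do rewrite ReM.
  by apply: measurable_funB; exact: measurable_funM.
under eq_fun do rewrite ImM.
by apply: measurable_funD; exact: measurable_funM.
Qed.

Lemma cmeasurableJ u : cmeasurable u -> cmeasurable (fun x => conjc (u x)).
Proof.
move=> [u1 u2]; split; first by under eq_fun do rewrite ReJ.
by under eq_fun do rewrite ImJ; exact: measurable_funN.
Qed.

Lemma cmeasurable_expi (s : T -> R) : measurable_fun [set: T] s ->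
  cmeasurable (fun x => expi (s x)).
Proof.
by move=> ms; split => /=; apply: measurableT_comp => //;
   apply: continuous_measurable_fun; [exact: continuous_cos|exact: continuous_sin].
Qed.

Lemma cmeasurableR (s : T -> R) : measurable_fun [set: T] s ->
  cmeasurable (fun x => (s x)%:C).
Proof. by move=> ms; split => //=; exact: measurable_cst. Qed.

Lemma cmeasurable_normc u : cmeasurable u ->
  measurable_fun [set: T] (fun x => normc (u x)).
Proof.
move=> [u1 u2].
rewrite (_ : (fun x => _) = (fun x => Num.sqrt (Re (u x) ^+ 2 + Im (u x) ^+ 2))).
  apply: (@measurableT_comp _ _ _ _ _ _ (@Num.sqrt R)).
    by apply: continuous_measurable_fun; exact: sqrt_continuous.
  by apply: measurable_funD; exact: measurable_funX.
by apply/funext => x; case: (u x).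
Qed.

End ComplexMeasurable.

Lemma cmeasurable_comp {R : realType} d d' (T : measurableType d)
    (T' : measurableType d') (u : T' -> R[i]) (f : T -> T') :
  cmeasurable u -> measurable_fun [set: T] f -> cmeasurable (fun x => u (f x)).
Proof.
by move=> [u1 u2] mf; split; [exact: (measurableT_comp u1)|exact: (measurableT_comp u2)].
Qed.
(** * Integrals of complex functions and Fubini's theorem *)

Section ComplexIntegral.
Context {R : realType}.
Implicit Types (u v : R -> R[i]) (f g : R -> R).

Definition cintegrable u :=
  mu.-integrable [set: R] (fun x => (Re (u x))%:E) /\
  mu.-integrable [set: R] (fun x => (Im (u x))%:E).

Lemma integrable_dominated f g : measurable_fun [set: R] f ->
  mu.-integrable [set: R] (EFin \o g) -> (forall x, `|f x| <= g x) ->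
  mu.-integrable [set: R] (EFin \o f).
Proof.
move=> mf ig fg; apply: le_integrable ig => //; first exact/measurable_EFinP.
by move=> x _ /=; rewrite lee_fin (le_trans (fg x))// ler_norm.
Qed.

Lemma cintegrable_cmeasurable u : cintegrable u -> cmeasurable u.
Proof.
by move=> [/measurable_int/measurable_EFinP ? /measurable_int/measurable_EFinP].
Qed.

Lemma cintegrable_le u g : cmeasurable u ->
  mu.-integrable [set: R] (EFin \o g) -> (forall x, normc (u x) <= g x) ->
  cintegrable u.
Proof.
move=> [u1 u2] ig ug; split; (apply: (integrable_dominated _ ig) => // x).
  exact: le_trans (ler_Re_normc _) _.
exact: le_trans (ler_Im_normc _) _.
Qed.

Lemma cintegrable_normc u : cintegrable u ->
  mu.-integrable [set: R] (EFin \o (fun x => normc (u x))).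
Proof.
move=> iu; have mu_ := cintegrable_cmeasurable iu; case: iu => i1 i2.
have := integrableD measurableT (integrable_abse i1) (integrable_abse i2).
move/integrable_dominated; apply; first exact: cmeasurable_normc.
move=> x /=; rewrite ger0_norm ?normc_ge0//.
rewrite -[X in _ <= X]ger0_norm ?addr_ge0// -ler_sqr ?nnegrE ?normc_ge0//.
by rewrite real_normK ?num_real// normcE2 sqrrD !real_normK ?num_real//
   -addrA lerD2l lerDr mulrn_wge0// mulr_ge0.
Qed.

Lemma cintegrableMbounded u v (M : R) : cintegrable u -> cmeasurable v ->
  (forall x, normc (v x) <= M) -> cintegrable (fun x => u x * v x).
Proof.
move=> iu mv vM.
apply: (@cintegrable_le _ (fun x => M * normc (u x))).
- by apply: cmeasurableM => //; exact: cintegrable_cmeasurable.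
- exact: (integrableZl measurableT M (cintegrable_normc iu)).
- move=> x; rewrite ComplexField.Normc.normcM mulrC ler_wpM2r//.
  exact: normc_ge0.
Qed.

Lemma cintegrableZl (z : R[i]) u : cintegrable u ->
  cintegrable (fun x => z * u x).
Proof.
move=> iu; under eq_fun do rewrite mulrC.
by apply: (cintegrableMbounded iu (cmeasurable_cst _ z)) => x; exact: lexx.
Qed.

Lemma cintegrableJ u : cintegrable u -> cintegrable (fun x => conjc (u x)).
Proof.
move=> [u1 u2]; split; first by under eq_fun do rewrite ReJ.
by under eq_fun do rewrite ImJ EFinN; exact: integrableN.
Qed.

Lemma cintegralD u v : cintegrable u -> cintegrable v ->
  cintegral (fun x => u x + v x) = cintegral u + cintegral v.
Proof.
move=> [u1 u2] [v1 v2]; apply: complex_ext; rewrite ?ReD ?ImD /cintegral /=.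
  by under eq_Rintegral do rewrite ReD; rewrite RintegralD.
by under eq_Rintegral do rewrite ImD; rewrite RintegralD.
Qed.

Lemma cintegralZl (z : R[i]) u : cintegrable u ->
  cintegral (fun x => z * u x) = z * cintegral u.
Proof.
move=> [u1 u2].
have iZ (k : R) f : mu.-integrable [set: R] (fun x => (f x)%:E) ->
    mu.-integrable [set: R] (EFin \o (fun x => k * f x)).
  by move=> i; exact: (integrableZl measurableT k i).
apply: complex_ext; rewrite ?ReM ?ImM /cintegral /=.
  under eq_Rintegral do rewrite ReM.
  by rewrite RintegralB ?RintegralZl//; exact: iZ.
under eq_Rintegral do rewrite ImM.
by rewrite RintegralD ?RintegralZl//; exact: iZ.
Qed.

Lemma cintegralJ u : cintegrable u ->
  cintegral (fun x => conjc (u x)) = conjc (cintegral u).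
Proof.
move=> [u1 u2]; apply: complex_ext; rewrite ?ReJ ?ImJ /cintegral /=.
  by apply: eq_Rintegral => x _; rewrite ReJ.
rewrite -mulN1r -RintegralZl//; apply: eq_Rintegral => x _.
by rewrite ImJ mulN1r.
Qed.

(** Rotate the integral onto the positive real axis and compare real parts. *)
Lemma normc_cintegral_le u : cintegrable u ->
  normc (cintegral u) <= \int[mu]_x normc (u x).
Proof.
move=> iu; set z := cintegral u.
have [->|z0] := eqVneq (normc z) 0.
  by apply: Rintegral_ge0 => x _; exact: normc_ge0.
have zgt0 : 0 < normc z by rewrite lt_def z0 normc_ge0.
rewrite -(ler_pM2l zgt0) -expr2.
have -> : normc z ^+ 2 = \int[mu]_x Re (conjc z * u x).
  transitivity (Re (cintegral (fun x => conjc z * u x))); last by [].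
  by rewrite cintegralZl// mulrC normc_mulJ.
rewrite -RintegralZl//; last exact: cintegrable_normc.
apply: le_Rintegral => //.
- exact: (cintegrableZl (conjc z) iu).1.
- exact: (integrableZl measurableT (normc z) (cintegrable_normc iu)).
- move=> x _; rewrite (le_trans (ler_norm _))// (le_trans (ler_Re_normc _))//.
  by rewrite ComplexField.Normc.normcM normc_conj.
Qed.

Lemma lee_normc_cintegral u : cintegrable u ->
  ((normc (cintegral u))%:E <= \int[mu]_x (normc (u x))%:E)%E.
Proof.
move=> iu; have inu := cintegrable_normc iu.
rewrite -[leRHS]fineK; last exact: integrable_fin_num.
by rewrite lee_fin; exact: normc_cintegral_le.
Qed.

End ComplexIntegral.

Section ComplexFubini.
Context {R : realType}.
Local Notation mu2 := ((@lebesgue_measure R) \x (@lebesgue_measure R))%E.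

(** The inner integrals may be infinite on a null set, where [Rintegral] returns
    a default value; hence the two almost-everywhere comparisons. *)
Lemma Rintegral_fubini (f : R * R -> R) :
  mu2.-integrable setT (EFin \o f) ->
  \int[mu]_x (\int[mu]_y f (x, y)) = \int[mu]_y (\int[mu]_x f (x, y)).
Proof.
move=> intf; rewrite /Rintegral; congr fine.
transitivity (\int[mu]_x \int[mu]_y (f (x, y))%:E)%E.
  apply: ae_eq_integral => //.
  - by apply/measurable_EFinP; apply: (@measurableT_comp _ _ _ _ _ _ fine) => //;
      exact: (measurable_fubini_F intf).
  - exact: (measurable_fubini_F intf).
  - apply: filterS (ae_integrable1 intf) => x ix _.
    by rewrite fineK//; exact: integrable_fin_num.
rewrite (Fubini intf).
apply: ae_eq_integral => //.
- exact: (measurable_fubini_G intf).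
- by apply/measurable_EFinP; apply: (@measurableT_comp _ _ _ _ _ _ fine) => //;
    exact: (measurable_fubini_G intf).
- apply: filterS (ae_integrable2 intf) => x ix _.
  by rewrite fineK//; exact: integrable_fin_num.
Qed.

Lemma cintegral_fubini (u : R * R -> R[i]) (g : R * R -> R) :
  cmeasurable u -> mu2.-integrable setT (EFin \o g) ->
  (forall z, normc (u z) <= g z) ->
  cintegral (fun x => cintegral (fun y => u (x, y))) =
  cintegral (fun y => cintegral (fun x => u (x, y))).
Proof.
move=> [u1 u2] ig ug; rewrite {1 3}/cintegral /=.
have i1 : mu2.-integrable setT (EFin \o (fun z => Re (u z))).
  apply: le_integrable ig => //; first exact/measurable_EFinP.
  move=> z _; rewrite lee_fin (le_trans (ler_Re_normc _))// (le_trans (ug z))//.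
  exact: ler_norm.
have i2 : mu2.-integrable setT (EFin \o (fun z => Im (u z))).
  apply: le_integrable ig => //; first exact/measurable_EFinP.
  move=> z _; rewrite lee_fin (le_trans (ler_Im_normc _))// (le_trans (ug z))//.
  exact: ler_norm.
by rewrite (Rintegral_fubini i1) (Rintegral_fubini i2).
Qed.

Lemma integrable_tensor (f g : R -> R) :
  mu.-integrable setT (EFin \o f) -> mu.-integrable setT (EFin \o g) ->
  mu2.-integrable setT (EFin \o (fun z : R * R => `|f z.1| * `|g z.2|)).
Proof.
move=> intf intg.
have mf : measurable_fun setT f by move/measurable_int/measurable_EFinP : intf.
have mg : measurable_fun setT g by move/measurable_int/measurable_EFinP : intg.
apply/integrable12ltyP.
  apply/measurable_EFinP; apply: measurable_funM.
    apply: measurableT_comp => //. exact: (measurableT_comp mf).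
  by apply: measurableT_comp => //; apply: (measurableT_comp mg).
rewrite [ltLHS](_ : _ = (\int[mu]_x `|(f x)%:E| * \int[mu]_x `|(g x)%:E|)%E).
  move/integrableP : intf => [_ f_lty]; move/integrableP : intg => [_ g_lty].
  by apply: lte_mul_pinfty => //; rewrite ?integral_ge0// ge0_fin_numE ?integral_ge0.
under eq_integral => x _.
  under eq_integral => y _ do rewrite /= ger0_norm ?mulr_ge0// EFinM.
  rewrite ge0_integralZl//; last first.
  - by apply/measurable_EFinP; exact: measurableT_comp.
  over.
rewrite /= ge0_integralZr//.
- by apply/measurable_EFinP; exact: measurableT_comp.
- by rewrite integral_ge0.
Qed.

(** The integral is the difference of the integrals of the positive and negative
    parts, both measurable, with values in the extended reals, by Tonelli. *)
Lemma measurable_Rintegral_param (f : R * R -> R) :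
  measurable_fun setT f -> measurable_fun setT (fun x => \int[mu]_y f (x, y)).
Proof.
move=> mf.
have me : measurable_fun setT (EFin \o f) by exact/measurable_EFinP.
apply: (@measurableT_comp _ _ _ _ _ _ fine) => //.
rewrite (_ : (fun x => _) = fun x => ((\int[mu]_y (EFin \o f)^\+ (x, y)) -
   (\int[mu]_y (EFin \o f)^\- (x, y)))%E).
  apply: emeasurable_funB; apply: measurable_fun_fubini_tonelli_F => //.
    exact: measurable_funepos.
  exact: measurable_funeneg.
apply/funext => x; rewrite integralE.
by congr (_ - _)%E; apply: eq_integral => y _; rewrite ?funeposE ?funenegE.
Qed.

Lemma cmeasurable_cintegral_param (u : R * R -> R[i]) :
  cmeasurable u -> cmeasurable (fun x => cintegral (fun y => u (x, y))).
Proof.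
move=> [u1 u2]; split.
  exact: (measurable_Rintegral_param u1).
exact: (measurable_Rintegral_param u2).
Qed.

End ComplexFubini.
(** * The Fourier transform *)

Section MeasurePreserving.
Context {R : realType}.

(** The positive and negative parts of [f] are transported separately, so the
    identity also holds, by convention, for an undefined integral. *)
Lemma integral_measure_preserving (phi : R -> R) (f : R -> \bar R) :
  measurable_fun [set: R] phi ->
  (forall X : set R, measurable X -> mu (phi @^-1` X) = mu X) ->
  measurable_fun [set: R] f ->
  (\int[mu]_x f (phi x) = \int[mu]_x f x)%E.
Proof.
move=> mphi phimu mf.
have ge0 (g : R -> \bar R) : measurable_fun [set: R] g ->
    (forall x, (0 <= g x)%E) ->
    (\int[mu]_x g (phi x) = \int[mu]_x g x)%E.
  move=> mg g0.
  transitivity (\int[pushforward mu (phi : measurableTypeR R -> measurableTypeR R)]_x g x)%E.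
    by rewrite ge0_integral_pushforward// => x _; exact: g0.
  by apply: eq_measure_integral => X mX _; exact: phimu.
rewrite [LHS]integralE [RHS]integralE; congr (_ - _)%E.
  rewrite -[RHS]ge0; [|exact: measurable_funepos|by []].
  by apply: eq_integral => x _; rewrite !funeposE.
rewrite -[RHS]ge0; [|exact: measurable_funeneg|by []].
by apply: eq_integral => x _; rewrite !funenegE.
Qed.

Lemma lebesgue_measure_shift (a : R) (X : set R) : measurable X ->
  mu ((fun x => x + a) @^-1` X) = mu X.
Proof.
move=> mX; apply/esym.
have ma : measurable_fun [set: R] (fun x : R => x + a).
  exact: measurable_funD.
apply: (@lebesgue_measure_unique _
  (pushforward mu (fun x : R => x + a : measurableTypeR R))) => //= _ [[b c]] _ <-.
rewrite /pushforward.
rewrite (_ : _ @^-1` _ = `]b - a, c - a]%classic); last first.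
  by apply/seteqP; split => x /=; rewrite !in_itv /= ltrBlDr lerBrDr.
rewrite !lebesgue_measure_itv /= !lte_fin ltrD2r.
by case: ifP => // _; rewrite -!EFinB; congr EFin; ring.
Qed.

Lemma Rintegral_shift (a : R) (f : R -> R) : measurable_fun [set: R] f ->
  \int[mu]_x f (x + a) = \int[mu]_x f x.
Proof.
move=> mf; congr fine; apply: (integral_measure_preserving (f := EFin \o f)).
- exact: measurable_funD.
- exact: lebesgue_measure_shift.
- exact/measurable_EFinP.
Qed.

Lemma Rintegral_reflect (f : R -> R) : measurable_fun [set: R] f ->
  \int[mu]_x f (- x) = \int[mu]_x f x.
Proof.
move=> mf; congr fine; apply: (integral_measure_preserving (f := EFin \o f)).
- by [].
- by move=> X mX; exact: lebesgue_measureN.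
- exact/measurable_EFinP.
Qed.

Lemma cintegral_shift (a : R) (u : R -> R[i]) : cmeasurable u ->
  cintegral (fun x => u (x + a)) = cintegral u.
Proof.
move=> [u1 u2]; apply: complex_ext; first exact: (Rintegral_shift a u1).
exact: (Rintegral_shift a u2).
Qed.

End MeasurePreserving.

Section FourierTransform.
Context {R : realType}.
Implicit Types (c psi : R -> R[i]) (x y z s : R).

Lemma cmeasurable_twist c y : cmeasurable c ->
  cmeasurable (fun x => expi (- (2 * pi * x * y)) * c x).
Proof.
move=> mc; apply: cmeasurableM => //; apply: cmeasurable_expi.
by apply: measurable_funN; apply: measurable_funM => //; apply: measurable_funM.
Qed.

Lemma cintegrable_twist c y : cintegrable c ->
  cintegrable (fun x => expi (- (2 * pi * x * y)) * c x).
Proof.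
move=> ic; apply: (@cintegrable_le _ _ (fun x => normc (c x))).
- by apply: cmeasurable_twist; exact: cintegrable_cmeasurable.
- exact: cintegrable_normc.
- by move=> x; rewrite ComplexField.Normc.normcM normc_expi mul1r.
Qed.

Lemma normc_fourier_le c y : cintegrable c ->
  normc (fourier c y) <= \int[mu]_x normc (c x).
Proof.
move=> ic; apply: le_trans (normc_cintegral_le (cintegrable_twist y ic)) _.
under eq_Rintegral do rewrite ComplexField.Normc.normcM normc_expi mul1r.
exact: lexx.
Qed.

Lemma cmeasurable_fourier c : cmeasurable c -> cmeasurable (fourier c).
Proof.
move=> mc.
apply: (@cmeasurable_cintegral_param _
  (fun p => expi (- (2 * pi * p.2 * p.1)) * c p.2)).
apply: cmeasurableM; last exact: cmeasurable_comp mc measurable_snd.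
apply: cmeasurable_expi; apply: measurable_funN.
apply: measurable_funM => //; apply: measurable_funM => //.
Qed.

Lemma fourierD c1 c2 y : cintegrable c1 -> cintegrable c2 ->
  fourier (fun x => c1 x + c2 x) y = fourier c1 y + fourier c2 y.
Proof.
move=> i1 i2; rewrite -cintegralD; try exact: cintegrable_twist.
by congr cintegral; apply/funext => x; rewrite mulrDr.
Qed.

Lemma fourierZ (k : R[i]) c y : cintegrable c ->
  fourier (fun x => k * c x) y = k * fourier c y.
Proof.
move=> ic; rewrite -cintegralZl; last exact: cintegrable_twist.
by congr cintegral; apply/funext => x; rewrite mulrCA.
Qed.

Lemma fourier_conj c y : cintegrable c ->
  fourier (fun x => conjc (c x)) y = conjc (fourier c (- y)).
Proof.
move=> ic; rewrite -cintegralJ; last exact: cintegrable_twist.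
by congr cintegral; apply/funext => x; rewrite conjcM expiJ mulrN opprK.
Qed.

Lemma fourier_modulation s c y :
  fourier (fun x => expi (- (2 * pi * s * x)) * c x) y = fourier c (y + s).
Proof.
congr cintegral; apply/funext => x; rewrite mulrA -expiD; congr (expi _ * _).
by ring.
Qed.

Lemma fourier_shift s c y : cintegrable c ->
  fourier (fun x => c (x + s)) y = expi (2 * pi * s * y) * fourier c y.
Proof.
move=> ic; rewrite -cintegralZl; last exact: cintegrable_twist.
rewrite -[RHS](cintegral_shift s); last first.
  apply: cmeasurableM; first exact: cmeasurable_cst.
  by apply: cmeasurable_twist; exact: cintegrable_cmeasurable.
congr cintegral; apply/funext => x; rewrite mulrA -expiD; congr (expi _ * _).
by ring.
Qed.

(** The multiplication formula: exchange the two integrals and absorb the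
    character in the first factor. *)
Lemma fourier_mul_fourier psi c y : cintegrable psi -> cintegrable c ->
  fourier (fun x => psi x * fourier c x) y =
  cintegral (fun z => c z * fourier psi (y + z)).
Proof.
move=> ipsi ic.
have [mpsi mc] := (cintegrable_cmeasurable ipsi, cintegrable_cmeasurable ic).
pose u (p : R * R) := expi (- (2 * pi * p.1 * (y + p.2))) * (psi p.1 * c p.2).
transitivity (cintegral (fun x => cintegral (fun z => u (x, z)))).
  congr cintegral; apply/funext => x; rewrite mulrA -cintegralZl; last first.
    exact: cintegrable_twist.
  congr cintegral; apply/funext => z; rewrite /u /=.
  transitivity (expi (- (2 * pi * x * y)) * expi (- (2 * pi * z * x)) *
                (psi x * c z)); first by ring.
  by rewrite -expiD; congr (expi _ * _); ring.
rewrite (@cintegral_fubini _ _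
    (fun p => `|normc (psi p.1)| * `|normc (c p.2)|)); first last.
- move=> p; rewrite !ComplexField.Normc.normcM normc_expi mul1r.
  by rewrite !ger0_norm ?normc_ge0.
- exact: integrable_tensor (cintegrable_normc ipsi) (cintegrable_normc ic).
- apply: cmeasurableM.
    apply: cmeasurable_expi; apply: measurable_funN.
    apply: measurable_funM => //; first exact: measurable_funM.
    exact: measurable_funD.
  apply: cmeasurableM; first exact: cmeasurable_comp mpsi measurable_fst.
  exact: cmeasurable_comp mc measurable_snd.
congr cintegral; apply/funext => z.
rewrite -cintegralZl; last exact: cintegrable_twist.
by congr cintegral; apply/funext => x; rewrite /u /=; ring.
Qed.

End FourierTransform.
(** * The Abel kernel and its Poisson transform *)

Section AbelKernel.
Context {R : realType}.
Implicit Types (l k x y : R).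

Definition abel l y : R := expR (- (l * `|y|)).

(** A primitive of [exp (- l y) (1 + cos (k y))], vanishing at infinity. *)
Let primitive l k y : R :=
  expR (- (l * y)) * ((k * sin (k * y) - l * cos (k * y)) / (l ^+ 2 + k ^+ 2) - l^-1).

Let is_derive_primitive l k y : 0 < l ->
  is_derive y 1 (primitive l k) (expR (- (l * y)) * (1 + cos (k * y))).
Proof.
move=> l0; rewrite /primitive.
have ln : l != 0 by rewrite gt_eqF.
have dn : l ^+ 2 + k ^+ 2 != 0.
  by rewrite gt_eqF// ltr_wpDr ?sqr_ge0// exprn_gt0.
apply: is_derive_eq.
rewrite /GRing.scale /= !mulr0 ?addr0.
by field; rewrite ln dn.
Qed.

Let primitive_cvg l k : 0 < l -> primitive l k y @[y --> +oo] --> 0.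
Proof.
move=> l0; set C := (`|k| + l) / (l ^+ 2 + k ^+ 2) + l^-1.
have d0 : 0 < l ^+ 2 + k ^+ 2 by rewrite ltr_wpDr ?sqr_ge0// exprn_gt0.
have C0 : 0 < C by rewrite ltr_wpDl ?invr_gt0// divr_ge0// ltW// ltr_wpDl.
have primC y : `|primitive l k y| <= expR (- (l * y)) * C.
  rewrite normrM ger0_norm ?expR_ge0// ler_wpM2l ?expR_ge0//.
  rewrite (le_trans (ler_normB _ _))// lerD//; last by rewrite ger0_norm// invr_ge0 ltW.
  rewrite normrM [X in _ * X]ger0_norm ?invr_ge0 ?(ltW d0)// ler_wpM2r ?invr_ge0 ?(ltW d0)//.
  rewrite (le_trans (ler_normB _ _))// !normrM lerD//.
    by rewrite ler_piMr// ler_norml sin_geN1 sin_le1.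
  by rewrite [X in X * _]ger0_norm ?(ltW l0)// ler_piMr ?(ltW l0)// ler_norml cos_geN1 cos_le1.
(* exp (- x) <= 1 / (1 + x) turns the limit into an explicit threshold. *)
apply/cvgr0Pnorm_lt => e e0; near=> y.
have y0 : 0 < y by near: y; apply: nbhs_pinfty_gt; rewrite num_real.
apply: le_lt_trans (primC y) _.
rewrite expRN mulrC ltr_pdivrMr ?expR_gt0//.
have : C / e / l < y by near: y; apply: nbhs_pinfty_gt; rewrite num_real.
rewrite ltr_pdivrMr// ltr_pdivrMr// => /lt_le_trans; apply.
rewrite mulrC ler_pM2l// (le_trans _ (expR_ge1Dx _))//.
by rewrite mulrC lerDr.
Unshelve. all: by end_near. Qed.

Lemma continuous_abel l : continuous (abel l).
Proof.
move=> y; rewrite /abel.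
apply: (@continuous_comp _ _ _ (fun y => - (l * `|y|)) expR); last first.
  exact: continuous_expR.
apply: (@continuousN _ _ _ (fun y => l * `|y|)).
apply: continuousM; first exact: cvg_cst.
exact: norm_continuous.
Qed.

Let continuous_cosM k : continuous (fun y => cos (k * y)).
Proof.
move=> y; apply: (@continuous_comp _ _ _ ( *%R k) cos); last exact: continuous_cos.
exact: mulrl_continuous.
Qed.

(** Adding the constant 1 to the cosine makes the integrand nonnegative, as
    required both by the improper fundamental theorem of calculus and by the
    reduction of an even integral to the half-line. *)
Let integral_abel_1Dcos l k : 0 < l ->
  (\int[mu]_y (abel l y * (1 + cos (k * y)))%:E =
   (2 * (l^-1 + l / (l ^+ 2 + k ^+ 2)))%:E)%E.
Proof.
move=> l0.
have cf : continuous (fun y => abel l y * (1 + cos (k * y))).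
  move=> y; apply: continuousM; first exact: continuous_abel.
  by apply: continuousD; [exact: cvg_cst|exact: continuous_cosM].
rewrite ge0_symfun_integralT//; last 2 first.
- by move=> y; rewrite mulr_ge0 ?expR_ge0// -lerBlDl sub0r cos_geN1.
- by move=> y /=; rewrite /abel normrN mulrN cosN.
rewrite EFinM -set_itvcy; congr (_ * _)%E.
transitivity (\int[mu]_(y in `[0%R, +oo[) (expR (- (l * y)) * (1 + cos (k * y)))%:E)%E.
  apply: eq_integral => y; rewrite inE /= in_itv /= andbT => y0.
  by rewrite /abel ger0_norm.
have cf' : continuous (fun y => expR (- (l * y)) * (1 + cos (k * y))).
  move=> y; apply: (@continuousM _ _ (fun y => expR (- (l * y))) (fun y => 1 + cos (k * y))).
    apply: (@continuous_comp _ _ _ (fun y => - (l * y)) expR); last exact: continuous_expR.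
    by apply: (@continuousN _ _ _ ( *%R l)); exact: mulrl_continuous.
  by apply: continuousD; [exact: cvg_cst|exact: continuous_cosM].
have cF : continuous (primitive l k).
  move=> y; apply/differentiable_continuous/derivable1_diffP.
  exact: (@ex_derive _ _ _ _ _ _ _ (is_derive_primitive k y l0)).
rewrite (ge0_continuous_FTC2y _ _ (primitive_cvg k l0)).
- rewrite /primitive !mulr0 oppr0 expR0 sin0 cos0 -EFinB; congr EFin.
  by field; rewrite !gt_eqF// ltr_wpDr ?sqr_ge0// exprn_gt0.
- by move=> y _; rewrite mulr_ge0 ?expR_ge0// -lerBlDl sub0r cos_geN1.
- exact: continuous_subspaceT.
- by move=> y _; exact: (@ex_derive _ _ _ _ _ _ _ (is_derive_primitive k y l0)).
- by apply: cvg_at_right_filter; exact: cF.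
- move=> y _; rewrite derive1E.
  exact: (@derive_val _ _ _ _ _ _ _ (is_derive_primitive k y l0)).
Qed.

Lemma abel_gt0 l y : 0 < abel l y.
Proof. exact: expR_gt0. Qed.

Lemma abel_le1 l y : 0 < l -> abel l y <= 1.
Proof. by move=> l0; rewrite -expR0 ler_expR oppr_le0 mulr_ge0// ltW. Qed.

Lemma measurable_abel l : measurable_fun [set: R] (abel l).
Proof. by apply: continuous_measurable_fun; exact: continuous_abel. Qed.

Lemma integrable_abel l : 0 < l -> mu.-integrable [set: R] (EFin \o abel l).
Proof.
move=> l0; apply/integrableP; split; first by apply/measurable_EFinP; exact: measurable_abel.
apply: (@le_lt_trans _ _ (\int[mu]_y (abel l y * (1 + cos (0 * y)))%:E)%E).
  apply: ge0_le_integral => //.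
  - by do 2 apply: measurableT_comp => //; exact: measurable_abel.
  - apply/measurable_EFinP; apply: measurable_funM; first exact: measurable_abel.
    apply: measurable_funD => //; apply: continuous_measurable_fun.
    exact: continuous_cosM.
  - move=> y _; rewrite /= lee_fin ger0_norm ?expR_ge0// ler_peMr ?expR_ge0//.
    by rewrite mul0r cos0 lerDl.
by rewrite integral_abel_1Dcos// ltry.
Qed.

Lemma cintegrable_abel l : 0 < l -> cintegrable (fun y => (abel l y)%:C).
Proof.
move=> l0; apply: (@cintegrable_le _ _ (abel l)).
- by apply: cmeasurableR; exact: measurable_abel.
- exact: integrable_abel.
- by move=> y; rewrite normcR ger0_norm// expR_ge0.
Qed.

(** The Poisson kernel, up to normalisation. *)
Lemma fourier_abel l x : 0 < l ->
  fourier (fun y => (abel l y)%:C) x = (2 * l / (l ^+ 2 + (2 * pi * x) ^+ 2))%:C.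
Proof.
move=> l0; set k := 2 * pi * x.
have mabel := measurable_abel l.
have mcos : measurable_fun [set: R] (fun y => cos (k * y)).
  by apply: continuous_measurable_fun; exact: continuous_cosM.
have Icos (j : R) : \int[mu]_y (abel l y * (1 + cos (j * y))) =
    2 * (l^-1 + l / (l ^+ 2 + j ^+ 2)).
  by rewrite /Rintegral integral_abel_1Dcos.
have iE : mu.-integrable [set: R] (EFin \o (fun y => abel l y * (1 + cos (0 * y)))).
  have := integrableZl measurableT 2 (integrable_abel l0).
  by apply: eq_integrable => // y _ /=; rewrite mul0r cos0 -EFinM mulrC.
have icos : mu.-integrable [set: R] (EFin \o (fun y => abel l y * cos (k * y))).
  apply: (integrable_dominated _ (integrable_abel l0)); first exact: measurable_funM.
  move=> y; rewrite normrM ger0_norm ?expR_ge0// ler_piMr ?expR_ge0//.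
  by rewrite ler_norml cos_geN1 cos_le1.
apply: complex_ext.
  transitivity (\int[mu]_y (abel l y * cos (k * y))).
    apply: eq_Rintegral => y _; rewrite ReM /= mulr0 subr0 cosN mulrC.
    by congr (_ * cos _); rewrite /k; ring.
  (* 1 is half of 1 + cos (0 * y), so both integrals are instances of Icos. *)
  transitivity (\int[mu]_y (abel l y * (1 + cos (k * y))) -
                2^-1 * \int[mu]_y (abel l y * (1 + cos (0 * y)))).
    rewrite -RintegralZl// -RintegralB//; last 2 first.
    - have := integrableD measurableT (integrable_abel l0) icos.
      by apply: eq_integrable => // y _ /=; rewrite mulrDr mulr1 EFinD.
    - exact: (integrableZl measurableT 2^-1 iE).
    by apply: eq_Rintegral => y _; rewrite mul0r cos0; field.
  rewrite !Icos /=; field.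
  by rewrite !gt_eqF// ?ltr_wpDr ?sqr_ge0// ?expr0n ?exprn_gt0.
transitivity (\int[mu]_y (- (abel l y * sin (k * y)))).
  apply: eq_Rintegral => y _; rewrite ImM /= mulr0 add0r sinN mulNr mulrC.
  by congr (- (_ * sin _)); rewrite /k; ring.
(* the integrand is odd *)
set f := fun y => _.
have mf : measurable_fun [set: R] f.
  apply: measurable_funN; apply: measurable_funM => //.
  apply: continuous_measurable_fun => y.
  apply: (@continuous_comp _ _ _ ( *%R k) sin); last exact: continuous_sin.
  exact: mulrl_continuous.
have if_ : mu.-integrable [set: R] (EFin \o f).
  apply: (integrable_dominated mf (integrable_abel l0)).
  move=> y; rewrite normrN normrM ger0_norm ?expR_ge0// ler_piMr ?expR_ge0//.
  by rewrite ler_norml sin_geN1 sin_le1.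
have fodd : \int[mu]_y f y = - \int[mu]_y f y.
  rewrite -{1}(Rintegral_reflect mf) -mulN1r -RintegralZl//.
  apply: eq_Rintegral => y _; rewrite /f /abel normrN mulrN sinN; ring.
by rewrite /= -/f; lra.
Qed.

End AbelKernel.
(** * Functions with spectrum in an interval *)

Section Bands.
Context {R : realType}.
Implicit Types (u v psi : R -> R[i]) (a b s : R).

Definition cbounded v := exists M : R, forall y, normc (v y) <= M.

(** The spectrum of [v] lies in [[a, b]]: the transform of [psi * v] at [x0] would
    be the convolution of those of [psi] and [v], so it is controlled by the values
    of [fourier psi] on the translate of [[a, b]] by [x0].  Stated by duality, this
    makes sense for a [v] that is merely bounded. *)
Definition band a b v :=
  [/\ cmeasurable v, cbounded v &
   exists2 M : R, 0 <= M & forall psi (eta x0 : R), cintegrable psi ->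
     (forall x, x0 + a <= x <= x0 + b -> normc (fourier psi x) <= eta) ->
     normc (fourier (fun y => psi y * v y) x0) <= M * eta].

Lemma band_cst (k : R[i]) : band 0 0 (fun=> k).
Proof.
split; [exact: cmeasurable_cst|by exists (normc k) => y|].
exists (normc k) => [|psi eta x0 ipsi psi_eta]; first exact: normc_ge0.
under [X in fourier X]eq_fun do rewrite mulrC.
rewrite fourierZ// ComplexField.Normc.normcM ler_wpM2l ?normc_ge0//.
by apply: psi_eta; rewrite addr0 lexx.
Qed.

(** A character has its spectrum at one point, because multiplying by it
    translates the transform of the test function. *)
Lemma band_expi s : band s s (fun y => expi (- (2 * pi * s * y))).
Proof.
split.
- by apply: cmeasurable_expi; apply: measurable_funN; exact: measurable_funM.
- by exists 1 => y; rewrite normc_expi.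
- exists 1 => // psi eta x0 ipsi psi_eta.
  under [X in fourier X]eq_fun do rewrite mulrC.
  by rewrite fourier_modulation mul1r; apply: psi_eta; rewrite lexx.
Qed.

Lemma cboundedM u v : cbounded u -> cbounded v -> cbounded (fun y => u y * v y).
Proof.
move=> [M uM] [N vN]; exists (M * N) => y.
by rewrite ComplexField.Normc.normcM ler_pM ?normc_ge0.
Qed.

(** Use the bound for [v] with [psi * u] as the test function: the transform of
    [psi * u] is small on the interval required by [v] because of the bound for
    [u].  Quantifying over all translates [x0] in [band] is what makes this work. *)
Lemma bandM a b a' b' u v : band a b u -> band a' b' v ->
  band (a + a') (b + b') (fun y => u y * v y).
Proof.
move=> [mu_ bu [M M0 Mu]] [mv bv [N N0 Nv]].
split; [exact: cmeasurableM|exact: cboundedM|].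
exists (N * M) => [|psi eta x0 ipsi psi_eta]; first exact: mulr_ge0.
under [X in fourier X]eq_fun do rewrite mulrA.
rewrite -mulrA; apply: Nv.
  by case: bu => K uK; exact: cintegrableMbounded uK.
move=> x /andP[ax xb]; apply: Mu => // y /andP[xy yx]; apply: psi_eta.
by apply/andP; split; lra.
Qed.

Lemma bandX a b v n : band a b v -> band (a *+ n) (b *+ n) (fun y => v y ^+ n).
Proof.
move=> bv; elim: n => [|n IH]; first exact: band_cst.
by under eq_fun do rewrite exprS; rewrite !mulrS; exact: bandM.
Qed.

Lemma bandJ a b v : band a b v -> band (- b) (- a) (fun y => conjc (v y)).
Proof.
move=> [mv [K vK] [M M0 Mv]]; split.
- exact: cmeasurableJ.
- by exists K => y; rewrite normc_conj.
exists M => // psi eta x0 ipsi psi_eta.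
have -> : (fun y => psi y * conjc (v y)) =
          (fun y => conjc (conjc (psi y) * v y)).
  by apply/funext => y; rewrite conjcM conjcK.
rewrite fourier_conj ?normc_conj; last first.
  by apply: cintegrableMbounded mv vK; exact: cintegrableJ.
apply: Mv; first exact: cintegrableJ.
move=> x /andP[ax xb]; rewrite fourier_conj// normc_conj.
by apply: psi_eta; apply/andP; split; lra.
Qed.

(** By the multiplication formula the pairing of [psi] with [fourier c] is an
    integral of the translated [fourier psi] against [c], which lives on [[a, b]]. *)
Lemma band_fourier a b (c : R -> R[i]) : cintegrable c ->
  (forall x, ~~ (a <= x <= b) -> c x = 0) -> band a b (fourier c).
Proof.
move=> ic c0; split.
- by apply: cmeasurable_fourier; exact: cintegrable_cmeasurable.
- by exists (\int[mu]_x normc (c x)) => y; exact: normc_fourier_le.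
exists (\int[mu]_x normc (c x)) => [|psi eta x0 ipsi psi_eta].
  by apply: Rintegral_ge0 => x _; exact: normc_ge0.
have ice : cintegrable (fun z => c z * fourier psi (x0 + z)).
  apply: (cintegrableMbounded ic (M := \int[mu]_x normc (psi x))).
    apply: (cmeasurable_comp (u := fourier psi)).
      by apply: cmeasurable_fourier; exact: cintegrable_cmeasurable.
    exact: measurable_funD.
  by move=> z; exact: normc_fourier_le.
rewrite fourier_mul_fourier//; apply: le_trans (normc_cintegral_le ice) _.
rewrite mulrC -RintegralZl//; last exact: cintegrable_normc.
apply: le_Rintegral => //; first exact: cintegrable_normc.
  exact: (integrableZl measurableT eta (cintegrable_normc ic)).
move=> z _; rewrite ComplexField.Normc.normcM mulrC.
have [ab|/c0 ->] := boolP (a <= z <= b).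
  by rewrite ler_wpM2r ?normc_ge0// psi_eta// !lerD2l.
by rewrite ComplexField.Normc.normc0 !mulr0.
Qed.

End Bands.

(** * Abel means of functions whose spectrum avoids 0 *)

Section AbelMeans.
Context {R : realType}.
Implicit Types (u v : R -> R[i]) (a b : R) (n : nat).

Lemma fourier_at0 v : fourier v 0 = cintegral v.
Proof.
congr cintegral; apply/funext => x.
by rewrite mulr0 oppr0 expi0 mul1r.
Qed.

Definition abel_mean n v : R[i] :=
  cintegral (fun y => (abel n.+1%:R^-1 y)%:C * v y).

(** The rate 1 / n makes the notion closed under finite sums, and only the limit 0
    of the means is needed to conclude in [cintegral_abel_null]. *)
Definition abel_null v := [/\ cmeasurable v, cbounded v &
  exists M : R, forall n, normc (abel_mean n v) <= M / n.+1%:R].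

Lemma cintegrable_abelM n v : cmeasurable v -> cbounded v ->
  cintegrable (fun y => (abel n.+1%:R^-1 y)%:C * v y).
Proof.
move=> mv [M vM]; apply: cintegrableMbounded mv vM.
by apply: cintegrable_abel; rewrite invr_gt0.
Qed.

Lemma abel_null0 : abel_null (fun=> 0).
Proof.
split; [exact: cmeasurable_cst| |].
  by exists 0 => y; rewrite ComplexField.Normc.normc0.
exists 0 => n; rewrite mul0r /abel_mean.
under [X in cintegral X]eq_fun do rewrite mulr0.
by rewrite /cintegral /= !Rintegral_cst// !mul0r expr0n addr0 sqrtr0.
Qed.

Lemma abel_nullD u v : abel_null u -> abel_null v ->
  abel_null (fun y => u y + v y).
Proof.
move=> [mu_ bu [M uM]] [mv bv [N vN]]; split; first exact: cmeasurableD.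
  case: bu bv => [K uK] [L vL]; exists (K + L) => y.
  by rewrite (le_trans (ler_normcD _ _))// lerD.
exists (M + N) => n; rewrite /abel_mean.
under [X in cintegral X]eq_fun do rewrite mulrDr.
rewrite cintegralD; try exact: cintegrable_abelM.
rewrite mulrDl (le_trans (ler_normcD _ _))// lerD//; [exact: uM|exact: vN].
Qed.

Lemma abel_nullN u : abel_null u -> abel_null (fun y => - u y).
Proof.
move=> [mu_ bu [M uM]].
rewrite (_ : (fun y => - u y) = (fun y => -1 * u y)); last first.
  by apply/funext => y; rewrite mulN1r.
split.
- by apply: cmeasurableM => //; exact: cmeasurable_cst.
- by case: bu => K uK; exists K => y; rewrite mulN1r normcN.
exists M => n; rewrite /abel_mean.
under [X in cintegral X]eq_fun do rewrite mulrCA.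
by rewrite cintegralZl ?mulN1r ?normcN; [exact: uM|exact: cintegrable_abelM].
Qed.

Lemma abel_null_sum (I : Type) (r : seq I) (P : pred I) (v : I -> R -> R[i]) :
  (forall i, P i -> abel_null (v i)) ->
  abel_null (fun y => \sum_(i <- r | P i) v i y).
Proof.
move=> vn; elim: r => [|i r IH].
  by under eq_fun do rewrite big_nil; exact: abel_null0.
under eq_fun do rewrite big_cons.
by have [Pi|//] := boolP (P i); exact: abel_nullD (vn i Pi) IH.
Qed.

(** At distance at least [d] from the origin the Poisson kernel of width [l] is at
    most [2 l / (2 pi d)^2], and the Abel mean of [v] only sees it on [[a, b]]. *)
Lemma abel_null_band a b v : band a b v -> 0 < a \/ b < 0 -> abel_null v.
Proof.
move=> [mv bv [M M0 Mv]] ab; split => //.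
have [d d0 dab] : exists2 d : R, 0 < d & forall x, a <= x <= b -> d <= `|x|.
  case: ab => [a0|b0].
    by exists a => // x /andP[ax _]; rewrite (le_trans ax)// ler_norm.
  exists (- b) => [|x /andP[_ xb]]; first by rewrite oppr_gt0.
  by rewrite -normrN (le_trans _ (ler_norm _))// lerN2.
exists (M * (2 / (2 * pi * d) ^+ 2)) => n; rewrite /abel_mean -fourier_at0.
rewrite -mulrA; apply: Mv.
  by apply: cintegrable_abel; rewrite invr_gt0.
move=> x; rewrite !add0r => /dab dx.
have l0 : 0 < n.+1%:R^-1 :> R by rewrite invr_gt0.
set l := n.+1%:R^-1 in l0 *.
have pd0 : 0 < (2 * pi * d) ^+ 2 by rewrite exprn_gt0// !mulr_gt0// pi_gt0.
rewrite fourier_abel// normcR ger0_norm; last first.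
  by rewrite mulr_ge0 ?invr_ge0 ?addr_ge0 ?sqr_ge0// mulr_ge0// ltW.
rewrite [leLHS]mulrAC ler_wpM2r ?(ltW l0)// ler_wpM2l//.
have dx2 : (2 * pi * d) ^+ 2 <= l ^+ 2 + (2 * pi * x) ^+ 2.
  apply: (@le_trans _ _ ((2 * pi * x) ^+ 2)); last by rewrite lerDr sqr_ge0.
  rewrite -[leRHS]real_normK ?num_real// normrM [`|2 * pi|]ger0_norm; last first.
    by rewrite mulr_ge0// pi_ge0.
  rewrite ler_sqr ?nnegrE ?mulr_ge0 ?pi_ge0 ?(ltW d0)//.
  by rewrite ler_wpM2l// mulr_ge0// pi_ge0.
by rewrite lef_pV2 ?posrE// (lt_le_trans pd0).
Qed.

Lemma cvg_abel (y : R) : abel n.+1%:R^-1 y @[n --> \oo] --> (1 : R).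
Proof.
rewrite /abel -[X in _ --> X]expR0.
apply: (@cvg_comp _ _ _ (fun n => - (n.+1%:R^-1 * `|y|)) expR); last exact: continuous_expR.
rewrite -oppr0 -[X in - X](mul0r `|y|).
apply: cvgN; apply: cvgM; last exact: cvg_cst.
exact: cvg_harmonic.
Qed.

Lemma cvg_abel_Rintegral (f : R -> R) : mu.-integrable [set: R] (EFin \o f) ->
  \int[mu]_y (abel n.+1%:R^-1 y * f y) @[n --> \oo] --> \int[mu]_y f y.
Proof.
move=> if_.
have mf : measurable_fun [set: R] f by move/measurable_int/measurable_EFinP : if_.
have [|||||_ _ cvgf] := @dominated_convergence _ _ R mu setT measurableT
  (fun n y => (abel n.+1%:R^-1 y * f y)%:E) (EFin \o f) (fun y => `|f y|%:E).
- by move=> n; apply/measurable_EFinP; apply: measurable_funM => //; exact: measurable_abel.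
- exact/measurable_EFinP.
- apply: nearW => y _; apply: cvg_EFin; first exact: nearW.
  rewrite -[X in _ --> X]mul1r; apply: cvgM; last exact: cvg_cst.
  exact: cvg_abel.
- exact: (integrable_abse if_).
- apply: nearW => y n _; rewrite lee_fin normrM (ger0_norm (ltW (abel_gt0 _ _))).
  by rewrite ler_piMl// abel_le1// invr_gt0.
apply: fine_cvg; rewrite fineK; first exact: cvgf.
exact: integrable_fin_num.
Qed.

Lemma cintegral_abel_null v : cintegrable v -> abel_null v -> cintegral v = 0.
Proof.
move=> [i1 i2] [_ _ [M vM]].
have lim0 (f : R -> R) : mu.-integrable [set: R] (EFin \o f) ->
    (forall n, `|\int[mu]_y (abel n.+1%:R^-1 y * f y)| <= M / n.+1%:R) ->
    \int[mu]_y f y = 0.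
  move=> if_ fM; have := cvg_abel_Rintegral if_.
  move/cvg_lim => <- //; apply/cvg_lim => //; apply: norm_cvg0.
  apply: (@squeeze_cvgr _ _ _ _ (fun=> 0) (fun n => M / n.+1%:R)).
  - by apply: nearW => n; rewrite normr_ge0 /= fM.
  - exact: cvg_cst.
  - by rewrite -(mulr0 M); apply: cvgM; [exact: cvg_cst|exact: cvg_harmonic].
apply: complex_ext; apply: lim0 => // n; apply: le_trans (vM n).
  apply: le_trans (ler_Re_normc _); rewrite le_eqVlt; apply/orP; left; apply/eqP.
  by congr `|_|; apply: eq_Rintegral => y _; rewrite ReM mul0r subr0.
apply: le_trans (ler_Im_normc _); rewrite le_eqVlt; apply/orP; left; apply/eqP.
by congr `|_|; apply: eq_Rintegral => y _; rewrite ImM mul0r addr0.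
Qed.

End AbelMeans.
(** * A Bessel inequality *)

Section BesselInequality.
Context {R : realType}.
Implicit Types (l x y z w : R).

Let poisson l x : R := 2 * l / (l ^+ 2 + (2 * pi * x) ^+ 2).

Let poisson_ge0 l x : 0 < l -> 0 <= poisson l x.
Proof. by move=> l0; rewrite divr_ge0 ?addr_ge0 ?sqr_ge0// mulr_ge0// ltW. Qed.

Let continuous_poisson l : 0 < l -> continuous (poisson l).
Proof.
move=> l0 x; rewrite /poisson; apply: (@continuousM _ _ (fun=> 2 * l)
  (fun x => (l ^+ 2 + (2 * pi * x) ^+ 2)^-1)); first exact: cvg_cst.
apply: (@continuousV _ _ (fun x => l ^+ 2 + (2 * pi * x) ^+ 2)).
  by rewrite gt_eqF// ltr_wpDr ?sqr_ge0// exprn_gt0.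
apply: (@continuousD _ _ _ (fun=> l ^+ 2)); first exact: cvg_cst.
apply: (@continuous_comp _ _ _ ( *%R (2 * pi)) (fun x => x ^+ 2)).
  exact: mulrl_continuous.
exact: exprn_continuous.
Qed.

Let measurable_poisson l : 0 < l -> measurable_fun [set: R] (poisson l).
Proof. by move=> l0; apply: continuous_measurable_fun; exact: continuous_poisson. Qed.

Let integral_poisson l : 0 < l -> (\int[mu]_x (poisson l x)%:E = 1)%E.
Proof.
move=> l0.
have k0 : 0 < 2 * pi / l :> R by rewrite divr_gt0// mulr_gt0// pi_gt0.
have pi0 : (pi : R) != 0 by rewrite gt_eqF// pi_gt0.
have dF x : is_derive x 1 (fun x => pi^-1 * atan (2 * pi / l * x)) (poisson l x).
  apply: is_derive_eq; rewrite /GRing.scale /= mulr1 /poisson.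
  have D0 : l ^+ 2 + (2 * pi * x) ^+ 2 != 0.
    by rewrite gt_eqF// ltr_wpDr ?sqr_ge0// exprn_gt0.
  have ln0 : l != 0 by rewrite gt_eqF.
  have -> : 1 + (2 * pi / l * x) ^+ 2 = (l ^+ 2 + (2 * pi * x) ^+ 2) / l ^+ 2.
    by field.
  by move: (pi : R) pi0 D0 => q q0 D0; field; rewrite q0 ln0 D0.
have cF : continuous (fun x : R => pi^-1 * atan (2 * pi / l * x)).
  by move=> x; apply/differentiable_continuous/derivable1_diffP; case: (dF x).
rewrite ge0_symfun_integralT; last 3 first.
- by move=> x; exact: poisson_ge0.
- exact: continuous_poisson.
- by move=> x /=; rewrite /poisson mulrN sqrrN.
rewrite -set_itvcy (ge0_continuous_FTC2y (F := fun x => pi^-1 * atan (2 * pi / l * x))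
   (l := pi^-1 * (pi / 2))).
- by rewrite mulr0 atan0 mulr0 -EFinB subr0 -EFinM mulKf// divff.
- by move=> x _; exact: poisson_ge0.
- by apply: continuous_subspaceT; exact: continuous_poisson.
- apply: cvgM; first exact: cvg_cst.
  apply: (@cvg_comp _ _ _ ( *%R (2 * pi / l)) atan _ (+oo)%R); last exact: cvgy_atan.
  exact: gt0_cvgMry.
- by move=> x _; case: (dF x).
- by apply: cvg_at_right_filter; exact: cF.
- by move=> x _; rewrite derive1E; exact: (@derive_val _ _ _ _ _ _ _ (dF x)).
Qed.


Let poisson_schur l z : 0 < l ->
  (\int[mu]_w (poisson l (w - z))%:E = 1)%E /\
  (\int[mu]_w (poisson l (z - w))%:E = 1)%E.
Proof.
move=> l0.
have shift1 (y : R) : (\int[mu]_w (poisson l (w + y))%:E = 1)%E.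
  rewrite -[RHS](integral_poisson l0).
  apply: (integral_measure_preserving (f := EFin \o poisson l)).
  - exact: measurable_funD.
  - exact: lebesgue_measure_shift.
  - by apply/measurable_EFinP; exact: measurable_poisson.
split; first exact: shift1.
rewrite -[RHS](shift1 (- z)); apply: eq_integral => w _.
by rewrite /poisson -[w - z]opprB [in RHS]mulrN sqrrN.
Qed.

(** Schur's test: bound [`|c z| `|c w|] by the mean of the squares and integrate
    out the variable on which the square does not depend. *)
Let schur_test l (r : R -> R) : 0 < l -> measurable_fun [set: R] r ->
  (forall x, 0 <= r x) ->
  (\int[mu]_z \int[mu]_w (r z * r w * poisson l (w - z))%:E <=
   \int[mu]_z (r z ^+ 2)%:E)%E.
Proof.
move=> l0 mr r0.
pose E1 (p : R * R) : \bar R := (2^-1 * r p.1 ^+ 2 * poisson l (p.2 - p.1))%:E.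
pose E2 (p : R * R) : \bar R := (2^-1 * r p.2 ^+ 2 * poisson l (p.2 - p.1))%:E.
have half_ge0 (x : R) : 0 <= 2^-1 * r x ^+ 2 by rewrite mulr_ge0// sqr_ge0.
have mker : measurable_fun [set: R * R] (fun p : R * R => poisson l (p.2 - p.1)).
  apply: (measurableT_comp (measurable_poisson l0)).
  exact: measurable_funB.
have mE1 : measurable_fun [set: R * R] E1.
  apply/measurable_EFinP; apply: measurable_funM => //.
  apply: measurable_funM => //; apply: measurable_funX.
  exact: (measurableT_comp mr).
have mE2 : measurable_fun [set: R * R] E2.
  apply/measurable_EFinP; apply: measurable_funM => //.
  apply: measurable_funM => //; apply: measurable_funX.
  exact: (measurableT_comp mr).
have E1_ge0 p : (0 <= E1 p)%E by rewrite lee_fin mulr_ge0// poisson_ge0.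
have E2_ge0 p : (0 <= E2 p)%E by rewrite lee_fin mulr_ge0// poisson_ge0.
pose E0 (p : R * R) : \bar R := (r p.1 * r p.2 * poisson l (p.2 - p.1))%:E.
have mE0 : measurable_fun [set: R * R] E0.
  apply/measurable_EFinP; apply: measurable_funM => //.
  by apply: measurable_funM; exact: (measurableT_comp mr).
have mhalf : measurable_fun [set: R] (fun z => (2^-1 * r z ^+ 2)%:E).
  by apply/measurable_EFinP; apply: measurable_funM => //; exact: measurable_funX.
have mF1 : measurable_fun [set: R] (fun z => \int[mu]_w E1 (z, w))%E.
  exact: (@measurable_fun_fubini_tonelli_F _ _
    (measurableTypeR R) (measurableTypeR R) R mu E1).
have mF2 : measurable_fun [set: R] (fun z => \int[mu]_w E2 (z, w))%E.
  exact: (@measurable_fun_fubini_tonelli_F _ _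
    (measurableTypeR R) (measurableTypeR R) R mu E2).
apply: (@le_trans _ _ (\int[mu]_z \int[mu]_w E1 (z, w) +
                       \int[mu]_z \int[mu]_w E2 (z, w))%E).
  rewrite -ge0_integralD//; last 2 first.
  - by move=> z _; exact: integral_ge0.
  - by move=> z _; exact: integral_ge0.
  apply: ge0_le_integral => //.
  - move=> z _; apply: integral_ge0 => w _.
    by rewrite lee_fin mulr_ge0 ?poisson_ge0// mulr_ge0.
  - apply: (@measurable_fun_fubini_tonelli_F _ _
      (measurableTypeR R) (measurableTypeR R) R mu E0) => // p.
    by rewrite lee_fin mulr_ge0 ?poisson_ge0// mulr_ge0.
  - by apply: emeasurable_funD; [exact: mF1|
                                 exact: mF2].
  - move=> z _; rewrite -ge0_integralD//; last 2 first.
    + exact: (measurable_fun_pair2 z mE1).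
    + exact: (measurable_fun_pair2 z mE2).
    apply: ge0_le_integral => //.
    + by move=> w _; rewrite lee_fin mulr_ge0 ?poisson_ge0// mulr_ge0.
    + exact: (measurable_fun_pair2 z mE0).
    + by apply: emeasurable_funD; [exact: (measurable_fun_pair2 z mE1)|
        exact: (measurable_fun_pair2 z mE2)].
    + move=> w _; rewrite -EFinD lee_fin -mulrDl ler_wpM2r ?poisson_ge0//.
      have := sqr_ge0 (r z - r w); rewrite /=; nra.
(* E2 carries the square of r at the inner variable: integrate it the other way. *)
rewrite [X in (_ + X)%E](@fubini_tonelli _ _
  (measurableTypeR R) (measurableTypeR R) R mu mu E2)//.
have I1 : (\int[mu]_z \int[mu]_w E1 (z, w) = \int[mu]_z (2^-1 * r z ^+ 2)%:E)%E.
  apply: eq_integral => z _; rewrite /E1 /=.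
  under eq_integral do rewrite EFinM.
  rewrite ge0_integralZl//; first by rewrite (poisson_schur z l0).1 mule1.
  - apply/measurable_EFinP; apply: (measurableT_comp (measurable_poisson l0)).
    exact: measurable_funB.
  - by move=> w _; rewrite lee_fin poisson_ge0.
  - by rewrite lee_fin.
have I2 : (\int[mu]_w \int[mu]_z E2 (z, w) = \int[mu]_w (2^-1 * r w ^+ 2)%:E)%E.
  apply: eq_integral => w _; rewrite /E2 /=.
  under eq_integral do rewrite EFinM.
  rewrite ge0_integralZl//; first by rewrite (poisson_schur w l0).2 mule1.
  - apply/measurable_EFinP; apply: (measurableT_comp (measurable_poisson l0)).
    exact: measurable_funB.
  - by move=> z _; rewrite lee_fin poisson_ge0.
  - by rewrite lee_fin.
rewrite I1 I2 -ge0_integralD//; last 2 first.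
- by move=> z _; rewrite lee_fin.
- by move=> z _; rewrite lee_fin.
rewrite le_eqVlt; apply/orP; left; apply/eqP; apply: eq_integral => z _.
by rewrite -EFinD; congr EFin; field.
Qed.

(** Writing the regularised energy as [fourier (abel * conj fourier c * fourier c)]
    at 0 and applying the multiplication formula twice turns it into the
    quadratic form of the Poisson kernel on [c], bounded by Schur's test. *)
Let abel_bessel l (c : R -> R[i]) : 0 < l -> cintegrable c ->
  (\int[mu]_y (abel l y * normc (fourier c y) ^+ 2)%:E <=
   \int[mu]_x (normc (c x) ^+ 2)%:E)%E.
Proof.
move=> l0 ic; have mc := cintegrable_cmeasurable ic.
have mF := cmeasurable_fourier mc.
have FK y : normc (fourier c y) <= \int[mu]_x normc (c x) by exact: normc_fourier_le.
have iabel := cintegrable_abel l0.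
have iaF : cintegrable (fun y => (abel l y)%:C * fourier c y).
  exact: cintegrableMbounded FK.
pose psi y := conjc ((abel l y)%:C * fourier c y).
have ipsi : cintegrable psi by exact: cintegrableJ.
have energyE : cintegral (fun y => psi y * fourier c y) =
    (\int[mu]_y (abel l y * normc (fourier c y) ^+ 2))%:C.
  have psiE y : psi y * fourier c y = (abel l y * normc (fourier c y) ^+ 2)%:C.
    rewrite /psi conjcM mulrAC -mulrA normc_mulJ.
    by apply: complex_ext; rewrite ?ReM ?ImM /=; ring.
  apply: complex_ext; first by apply: eq_Rintegral => y _; rewrite psiE.
  rewrite [RHS]/= -(mul0r (fine (mu [set: R]))) -Rintegral_cst//.
  by apply: eq_Rintegral => y _; rewrite psiE.
have ie : mu.-integrable [set: R]
    (EFin \o (fun y => abel l y * normc (fourier c y) ^+ 2)).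
  apply: (integrable_dominated _
    (integrableZl measurableT ((\int[mu]_x normc (c x)) ^+ 2) (integrable_abel l0))).
    apply: measurable_funM; first exact: measurable_abel.
    by apply: measurable_funX; exact: cmeasurable_normc.
  move=> y; rewrite ger0_norm; last by rewrite mulr_ge0 ?sqr_ge0// ltW// abel_gt0.
  rewrite [leLHS]mulrC ler_wpM2r ?(ltW (abel_gt0 _ _))//.
  have K0 := le_trans (normc_ge0 _) (FK y).
  by rewrite ler_sqr ?nnegrE ?normc_ge0.
have psi_le z : ((normc (fourier psi z))%:E <=
                 \int[mu]_w (normc (c w) * poisson l (w - z))%:E)%E.
  rewrite /psi fourier_conj// normc_conj fourier_mul_fourier//.
  apply: le_trans (lee_normc_cintegral _) _.
    apply: (cintegrableMbounded ic (M := \int[mu]_x normc (abel l x)%:C)).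
      apply: (cmeasurable_comp (u := fourier (fun y => (abel l y)%:C))).
        by apply: cmeasurable_fourier; exact: cintegrable_cmeasurable.
      exact: measurable_funD.
    by move=> w; exact: normc_fourier_le.
  rewrite le_eqVlt; apply/orP; left; apply/eqP; apply: eq_integral => w _.
  rewrite ComplexField.Normc.normcM [- z + w]addrC fourier_abel// normcR.
  by rewrite ger0_norm//; exact: poisson_ge0.
have energy_le : ((\int[mu]_y (abel l y * normc (fourier c y) ^+ 2))%:E <=
    \int[mu]_z (normc (c z) * normc (fourier psi z))%:E)%E.
  have -> : \int[mu]_y (abel l y * normc (fourier c y) ^+ 2) =
      normc (cintegral (fun z => c z * fourier psi (0 + z))).
    rewrite -fourier_mul_fourier// fourier_at0 energyE normcR ger0_norm//.
    by apply: Rintegral_ge0 => y _; rewrite mulr_ge0 ?sqr_ge0// ltW// abel_gt0.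
  apply: le_trans (lee_normc_cintegral _) _.
    apply: (cintegrableMbounded ic (M := \int[mu]_x normc (psi x))).
      apply: (cmeasurable_comp (u := fourier psi)).
        by apply: cmeasurable_fourier; exact: cintegrable_cmeasurable.
      exact: measurable_funD.
    by move=> w; exact: normc_fourier_le.
  rewrite le_eqVlt; apply/orP; left; apply/eqP; apply: eq_integral => w _.
  by rewrite ComplexField.Normc.normcM add0r.
rewrite -[leLHS]fineK; last exact: integrable_fin_num.
apply: le_trans energy_le _.
apply: le_trans (schur_test l0 (cmeasurable_normc mc) (fun x => normc_ge0 (c x))).
have mncz : measurable_fun [set: R] (fun z => normc (c z)) by exact: cmeasurable_normc.
have mkz z : measurable_fun [set: R] (fun w => (normc (c w) * poisson l (w - z))%:E).
  apply/measurable_EFinP; apply: measurable_funM => //.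
  by apply: (measurableT_comp (measurable_poisson l0)); exact: measurable_funB.
apply: ge0_le_integral => //.
- by move=> z _; rewrite lee_fin mulr_ge0// normc_ge0.
- apply/measurable_EFinP; apply: measurable_funM => //.
  by apply: cmeasurable_normc; apply: cmeasurable_fourier; exact: cintegrable_cmeasurable.
- apply: (@measurable_fun_fubini_tonelli_F _ _ (measurableTypeR R) (measurableTypeR R) R mu
    (fun p : R * R => (normc (c p.1) * normc (c p.2) * poisson l (p.2 - p.1))%:E)).
    apply/measurable_EFinP; apply: measurable_funM.
      by apply: measurable_funM; exact: (measurableT_comp mncz).
    apply: (measurableT_comp (measurable_poisson l0)).
    exact: measurable_funB.
  by move=> p; rewrite lee_fin mulr_ge0 ?poisson_ge0// mulr_ge0// normc_ge0.
- move=> z _.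
  under [leRHS]eq_integral do rewrite -mulrA EFinM.
  rewrite ge0_integralZl ?lee_fin ?normc_ge0//; last 2 first.
  + exact: mkz.
  + by move=> w _; rewrite lee_fin mulr_ge0 ?normc_ge0 ?poisson_ge0.
  rewrite EFinM; apply: lee_wpmul2l; first by rewrite lee_fin normc_ge0.
  exact: psi_le.
Qed.

(** The regularised energies are bounded uniformly in [l] and increase to the
    energy of [fourier c] as [l] tends to 0. *)
Lemma integrable_fourier_sqr (c : R -> R[i]) : cintegrable c ->
  mu.-integrable [set: R] (EFin \o (fun x => normc (c x) ^+ 2)) ->
  mu.-integrable [set: R] (EFin \o (fun y => normc (fourier c y) ^+ 2)).
Proof.
move=> ic ic2.
have mF : measurable_fun [set: R] (fun y => normc (fourier c y) ^+ 2).
  apply: measurable_funX; apply: cmeasurable_normc; apply: cmeasurable_fourier.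
  exact: cintegrable_cmeasurable.
apply/integrableP; split; first exact/measurable_EFinP.
pose f n y := (abel n.+1%:R^-1 y * normc (fourier c y) ^+ 2)%:E.
have f_ge0 n y : (0 <= f n y)%E by rewrite lee_fin mulr_ge0 ?sqr_ge0// ltW// abel_gt0.
have mf n : measurable_fun [set: R] (f n).
  by apply/measurable_EFinP; apply: measurable_funM => //; exact: measurable_abel.
have fcvg y : f n y @[n --> \oo] --> (normc (fourier c y) ^+ 2)%:E.
  apply: cvg_EFin; first exact: nearW.
  by rewrite -[X in _ --> X]mul1r; apply: cvgM; [exact: cvg_abel|exact: cvg_cst].
rewrite [ltLHS](_ : _ = \int[mu]_y limn (f^~ y))%E; last first.
  apply: eq_integral => y _.
  by rewrite /= ger0_norm ?sqr_ge0// (cvg_lim _ (fcvg y)).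
rewrite monotone_convergence//; last first.
  move=> y _ n m nm; rewrite lee_fin ler_wpM2r ?sqr_ge0// ler_expR lerN2.
  by rewrite ler_wpM2r// lef_pV2 ?posrE// ler_nat.
apply: (@le_lt_trans _ _ (\int[mu]_x (normc (c x) ^+ 2)%:E)%E).
  apply: lime_le; last first.
    by apply: nearW => n; apply: abel_bessel => //; rewrite invr_gt0.
  apply: ereal_nondecreasing_is_cvgn => n m nm; apply: ge0_le_integral => //; [exact: mf|exact: mf|].
  move=> y _; rewrite lee_fin ler_wpM2r ?sqr_ge0// ler_expR lerN2.
  by rewrite ler_wpM2r// lef_pV2 ?posrE// ler_nat.
move/integrableP : ic2 => [_]; apply: le_lt_trans; apply: ge0_le_integral => //.
- by move=> x _; rewrite lee_fin sqr_ge0.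
- apply/measurable_EFinP; apply: measurable_funX; apply: cmeasurable_normc.
  exact: cintegrable_cmeasurable.
- do 2 apply: measurableT_comp => //; apply: measurable_funX.
  by apply: cmeasurable_normc; exact: cintegrable_cmeasurable.
- by move=> x _; rewrite /= lee_fin ler_norm.
Qed.

End BesselInequality.
(** * Two modulated bands *)

Section TwoBands.
Context {R : realType}.
Variables (A : R) (a b : R -> R[i]).
Hypothesis A0 : 0 < A.
Hypothesis band_a : band 0 A a.
Hypothesis band_b : band (- A) 0 b.
Hypothesis a_L2 : mu.-integrable [set: R] (EFin \o (fun y => normc (a y) ^+ 2)).
Hypothesis b_L2 : mu.-integrable [set: R] (EFin \o (fun y => normc (b y) ^+ 2)).
Implicit Types (s t y : R) (m n j k : nat).

Let ea t y : R[i] := expi (- (2 * pi * t * y)) * a y.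
Let eb t y : R[i] := expi (- (2 * pi * (- t) * y)) * b y.

Definition two_bands t y : R[i] := ea t y + eb t y.

Let band_ea t : band t (t + A) (ea t).
Proof. by rewrite -{1}[t]addr0; apply: bandM; [exact: band_expi|]. Qed.

Let band_eb t : band (- t - A) (- t) (eb t).
Proof. by rewrite -{2}[- t]addr0; apply: bandM; [exact: band_expi|]. Qed.

Let term m t j y : R[i] := ea t y ^+ (m - j) * eb t y ^+ j * 'C(m, j)%:R.

Let band_term m t j : band (t *+ (m - j) + (- t - A) *+ j)
  ((t + A) *+ (m - j) + (- t) *+ j) (term m t j).
Proof.
rewrite -[X in band X _]addr0 -[X in band _ X]addr0.
by apply: bandM (band_cst _); apply: bandM; exact: bandX.
Qed.

Let two_bandsX m t y : two_bands t y ^+ m = \sum_(j < m.+1) term m t j y.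
Proof. by rewrite exprDn; apply: eq_bigr => j _; rewrite /term mulr_natr. Qed.

Let cross m t j k y : R[i] := term m t j y * conjc (term m t k y).

Let band_cross m t j k : band
  (t *+ (m - j) + (- t - A) *+ j - ((t + A) *+ (m - k) + (- t) *+ k))
  ((t + A) *+ (m - j) + (- t) *+ j - (t *+ (m - k) + (- t - A) *+ k))
  (cross m t j k).
Proof. by apply: bandM => //; apply: bandJ. Qed.

(** The endpoint of the band nearest to the origin is, up to sign, the quantity in
    [slack] for [d = |k - j|].  It is positive because its excess over [d] times
    [2 t - (m - 1) A] is [A m (d - 1)]. *)
Let abel_null_cross m t j k : (m%:R - 1) * A / 2 < t -> (j <= m)%N -> (k <= m)%N ->
  j != k -> abel_null (cross m t j k).
Proof.
move=> mt jm km jk; apply: abel_null_band (band_cross m t j k) _.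
have natE (x : R) n : x *+ n = x * n%:R by rewrite mulr_natr.
have slack (d : nat) : (0 < d)%N -> 0 < 2 * t * d%:R - A * (m%:R - d%:R).
  move=> d0; have d1 : 1 <= d%:R :> R by rewrite ler1n.
  rewrite (_ : _ - _ = (2 * t - (m%:R - 1) * A) * d%:R + A * m%:R * (d%:R - 1)); last by ring.
  rewrite ltr_wpDr ?mulr_ge0 ?subr_ge0 ?(ltW A0)//.
  by rewrite mulr_gt0 ?ltr0n// subr_gt0 [ltRHS]mulrC -ltr_pdivrMr.
move: jk; rewrite neq_ltn => /orP[jk|kj]; [left|right].
  have := slack (k - j)%N; rewrite subn_gt0 => /(_ jk).
  rewrite natrB ?(ltnW jk)// => S.
  rewrite !(natE t) !(natE (t + A)) !(natE (- t)) !(natE (- t - A)) !natrB//.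
  by move: S; congr (0 < _); ring.
have := slack (j - k)%N; rewrite subn_gt0 => /(_ kj).
rewrite natrB ?(ltnW kj)// => S.
rewrite !(natE t) !(natE (t + A)) !(natE (- t)) !(natE (- t - A)) !natrB// -oppr_gt0.
by move: S; congr (0 < _); ring.
Qed.

Let diagonal m y : R[i] := \sum_(j < m.+1)
  ((normc (a y) ^+ (m - j) * normc (b y) ^+ j * 'C(m, j)%:R) ^+ 2)%:C.

Let cross_diag m t j y : cross m t j j y =
  ((normc (a y) ^+ (m - j) * normc (b y) ^+ j * 'C(m, j)%:R) ^+ 2)%:C.
Proof.
rewrite /cross normc_mulJ; congr (_ ^+ 2)%:C.
rewrite !ComplexField.Normc.normcM !normcX !ComplexField.Normc.normcM.
rewrite !normc_expi !mul1r; congr (_ * _).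
by rewrite -(rmorph_nat (real_complex R)) normcR ger0_norm.
Qed.

(** Expand the power of [two_bands t] and of its conjugate; what remains after
    removing the diagonal is a sum of cross terms. *)
Let abel_null_off_diagonal m t : (m%:R - 1) * A / 2 < t ->
  abel_null (fun y => (normc (two_bands t y) ^+ (2 * m))%:C - diagonal m y).
Proof.
move=> mt.
have -> : (fun y => (normc (two_bands t y) ^+ (2 * m))%:C - diagonal m y) =
    (fun y => \sum_(j < m.+1) \sum_(k < m.+1 | k != j) cross m t j k y).
  have RX (x : R) n : (x ^+ n)%:C = x%:C ^+ n by exact: rmorphXn.
  apply/funext => y; rewrite exprM RX -normc_mulJ exprMn.
  have -> : conjc (two_bands t y) ^+ m = conjc (two_bands t y ^+ m).
    by apply/esym; exact: rmorphXn.
  have conj_sum (z : 'I_m.+1 -> R[i]) : conjc (\sum_j z j) = \sum_j conjc (z j).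
    exact: raddf_sum.
  rewrite two_bandsX conj_sum big_distrlr -sumrB /=.
  apply: eq_bigr => j _; rewrite (bigD1 j)//= -/(cross m t j j y) cross_diag.
  by rewrite addrAC subrr add0r.
apply: abel_null_sum => j _; apply: abel_null_sum => k kj.
apply: abel_null_cross => //; try by rewrite -ltnS.
by rewrite eq_sym.
Qed.

Let cmeasurable_two_bands t : cmeasurable (two_bands t).
Proof. by apply: cmeasurableD; [case: (band_ea t)|case: (band_eb t)]. Qed.

Let normc_two_bands_le t y : normc (two_bands t y) <= normc (a y) + normc (b y).
Proof.
rewrite (le_trans (ler_normcD _ _))// lerD// ComplexField.Normc.normcM.
  by rewrite normc_expi mul1r.
by rewrite normc_expi mul1r.
Qed.

(** Two of the [2 m] factors are kept for square-integrability, the others are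
    bounded; the bound is uniform in [t] because modulation preserves the modulus. *)
Let energy_dominated m : (0 < m)%N -> exists2 G : R -> R,
  mu.-integrable [set: R] (EFin \o G) &
  forall t y, normc (two_bands t y) ^+ (2 * m) <= G y.
Proof.
move=> m0; have [_ [Ka aK] _] := band_a; have [_ [Kb bK] _] := band_b.
pose K := (Ka + Kb) ^+ (2 * m.-1) * 2.
exists (fun y => K * (normc (a y) ^+ 2 + normc (b y) ^+ 2)).
  exact: (integrableZl measurableT K (integrableD measurableT a_L2 b_L2)).
move=> t y; have Fab := normc_two_bands_le t y.
have ab0 : 0 <= normc (a y) + normc (b y) := le_trans (normc_ge0 _) Fab.
have abK : normc (a y) + normc (b y) <= Ka + Kb by rewrite lerD.
rewrite (_ : (2 * m)%N = (2 * m.-1 + 2)%N); last by rewrite -[in LHS](prednK m0) mulnS addnC.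
rewrite exprD /K -mulrA; apply: ler_pM.
- by rewrite exprn_ge0// normc_ge0.
- by rewrite sqr_ge0.
- rewrite lerXn2r ?nnegrE ?normc_ge0 ?(le_trans ab0)//.
  exact: le_trans Fab _.
- apply: (@le_trans _ _ ((normc (a y) + normc (b y)) ^+ 2)).
    by rewrite ler_sqr ?nnegrE ?normc_ge0.
  by have := sqr_ge0 (normc (a y) - normc (b y)); nra.
Qed.

Let measurable_energy m t :
  measurable_fun [set: R] (fun y => normc (two_bands t y) ^+ (2 * m)).
Proof. by apply: measurable_funX; exact: cmeasurable_normc. Qed.

Let integrable_energy m t : (0 < m)%N ->
  mu.-integrable [set: R] (EFin \o (fun y => normc (two_bands t y) ^+ (2 * m))).
Proof.
move=> m0; have [G iG FG] := energy_dominated m0.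
apply: (integrable_dominated (measurable_energy m t) iG) => y.
by rewrite ger0_norm// exprn_ge0// normc_ge0.
Qed.

(** The diagonal cancels between two values of [t], leaving the difference of two
    integrable energies, whose Abel means tend to 0. *)
Let energy_constant m s t : (0 < m)%N ->
  (m%:R - 1) * A / 2 < s -> (m%:R - 1) * A / 2 < t ->
  \int[mu]_y normc (two_bands s y) ^+ (2 * m) =
  \int[mu]_y normc (two_bands t y) ^+ (2 * m).
Proof.
move=> m0 ms mt; apply/eqP; rewrite -subr_eq0 -RintegralB//; try exact: integrable_energy.
pose u y : R[i] := (normc (two_bands s y) ^+ (2 * m) -
                    normc (two_bands t y) ^+ (2 * m))%:C.
have iu : cintegrable u.
  split; last exact: integrable0.
  exact: (integrableB measurableT (integrable_energy s m0) (integrable_energy t m0)).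
have nu : abel_null u.
  have -> : u = (fun y => ((normc (two_bands s y) ^+ (2 * m))%:C - diagonal m y) +
      - ((normc (two_bands t y) ^+ (2 * m))%:C - diagonal m y)).
    by apply/funext => y; rewrite /u rmorphB; ring.
  by apply: abel_nullD; [|apply: abel_nullN]; exact: abel_null_off_diagonal.
by apply/eqP; have := cintegral_abel_null iu nu => /(congr1 (@complex.Re R)).
Qed.

(** Only the relative phase [4 pi t y] depends on [t]. *)
Let normc_two_bands_sqr t y : normc (two_bands t y) ^+ 2 =
  normc (a y) ^+ 2 + normc (b y) ^+ 2 +
  2 * (cos (4 * pi * t * y) * Re (a y * conjc (b y)) +
       sin (4 * pi * t * y) * Im (a y * conjc (b y))).
Proof.
set th := 2 * pi * t * y.
have -> : 4 * pi * t * y = th + th by rewrite /th; ring.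
rewrite cosD sinD !normcE2 /two_bands /ea /eb mulrN mulNr opprK.
rewrite -/th ReD ImD !ReM !ImM ReJ ImJ /= cosN sinN.
have := cos2Dsin2 th; move: (cos th) (sin th) => c s cs1.
move: (a y) (b y) => [p q] [v w] /=.
have cs1E (x : R) : x = (c ^+ 2 + s ^+ 2) * x by rewrite cs1 mul1r.
by rewrite [p ^+ 2 + q ^+ 2]cs1E [v ^+ 2 + w ^+ 2]cs1E; ring.
Qed.

Let cvg_energy m t y (u : nat -> R) : u n @[n --> \oo] --> t ->
  normc (two_bands (u n) y) ^+ (2 * m) @[n --> \oo] -->
  normc (two_bands t y) ^+ (2 * m).
Proof.
move=> ut.
under eq_fun do rewrite exprM normc_two_bands_sqr.
rewrite exprM normc_two_bands_sqr.
have uth : 4 * pi * u n * y @[n --> \oo] --> 4 * pi * t * y.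
  by apply: cvgM; [apply: cvgM; [exact: cvg_cst|]|exact: cvg_cst].
apply: (@cvg_comp _ _ _ _ (fun x : R => x ^+ m)); last exact: exprn_continuous.
apply: cvgD; first exact: cvg_cst.
apply: cvgM; first exact: cvg_cst.
apply: cvgD; (apply: cvgM; last exact: cvg_cst).
  by apply: (@cvg_comp _ _ _ _ cos); [exact: uth|exact: continuous_cos].
by apply: (@cvg_comp _ _ _ _ sin); [exact: uth|exact: continuous_sin].
Qed.

(** The energy is constant on the open half-line; it takes the same value at its
    endpoint because it is continuous from the right there. *)
Lemma two_bands_energy m t : (0 < m)%N -> (m%:R - 1) * A / 2 <= t ->
  (\int[mu]_y (normc (two_bands t y) ^+ (2 * m))%:E =
   \int[mu]_y (normc (two_bands ((m%:R - 1) * A / 2) y) ^+ (2 * m))%:E)%E.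
Proof.
move=> m0; set t0 := (m%:R - 1) * A / 2.
rewrite le_eqVlt => /predU1P[<-//|t0t].
have [G iG FG] := energy_dominated m0.
pose u n : R := t0 + n.+1%:R^-1.
have ut0 : u n @[n --> \oo] --> t0.
  by rewrite -[X in _ --> X]addr0; apply: cvgD; [exact: cvg_cst|exact: cvg_harmonic].
have [|||||_ _ cvgF] := @dominated_convergence _ _ R mu setT measurableT
  (fun n y => (normc (two_bands (u n) y) ^+ (2 * m))%:E)
  (fun y => (normc (two_bands t0 y) ^+ (2 * m))%:E) (EFin \o G).
- by move=> n; apply/measurable_EFinP; exact: measurable_energy.
- by apply/measurable_EFinP; exact: measurable_energy.
- apply: nearW => y _; apply: cvg_EFin; first exact: nearW.
  exact: cvg_energy.
- exact: iG.
- by apply: nearW => y n _; rewrite lee_fin ger0_norm// exprn_ge0// normc_ge0.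
have const n : (\int[mu]_y (normc (two_bands (u n) y) ^+ (2 * m))%:E =
                \int[mu]_y (normc (two_bands t y) ^+ (2 * m))%:E)%E.
  rewrite -[LHS]fineK; last exact: integrable_fin_num (integrable_energy _ m0).
  rewrite -[RHS]fineK; last exact: integrable_fin_num (integrable_energy _ m0).
  congr EFin; apply: energy_constant => //.
  by rewrite /u ltrDl invr_gt0.
move: cvgF; under eq_fun do rewrite const.
by move/cvg_lim => <- //; rewrite lim_cst.
Qed.

End TwoBands.
(** * Reduction of the shifted function to two bands *)

Section Reduction.
Context {R : realType}.
Implicit Types (h c : R -> R[i]) (E : set R) (A t y : R).

Lemma ae_cintegral u v : cmeasurable u -> cmeasurable v ->
  {ae (@lebesgue_measure R), forall x, u x = v x} -> cintegral u = cintegral v.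
Proof.
move=> [u1 u2] [v1 v2] uv; apply: complex_ext; congr fine; apply: ae_eq_integral => //;
  try exact/measurable_EFinP; by apply: filterS uv => x -> _.
Qed.

Lemma ae_cintegrable u v : cmeasurable u ->
  {ae (@lebesgue_measure R), forall x, u x = v x} -> cintegrable v -> cintegrable u.
Proof.
move=> mu_ uv iv.
have nu := cmeasurable_normc mu_.
have nv := cmeasurable_normc (cintegrable_cmeasurable iv).
apply: (@cintegrable_le _ _ (fun x => normc (u x))) => //.
apply/integrableP; split; first exact/measurable_EFinP.
move/integrableP : (cintegrable_normc iv) => [_]; apply: le_lt_trans.
rewrite le_eqVlt; apply/orP; left; apply/eqP.
apply: ae_eq_integral => //; try by do 2 apply: measurableT_comp => //.
by apply: filterS uv => x /= -> _.
Qed.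

Definition cutoff E h x : R[i] := (\1_E x)%:C * h x.

Lemma cmeasurable_cutoff E h : measurable E -> cmeasurable h ->
  cmeasurable (cutoff E h).
Proof.
move=> mE mh; apply: cmeasurableM => //; apply: cmeasurableR.
exact: measurable_indic.
Qed.

Lemma normc_cutoff E h x : normc (cutoff E h x) = \1_E x * normc (h x).
Proof.
by rewrite ComplexField.Normc.normcM normcR ger0_norm// indicE.
Qed.

Lemma cutoff_sqr_integrable E h : measurable E -> cmeasurable h ->
  mu.-integrable [set: R] (EFin \o (fun x => normc (h x) ^+ 2)) ->
  mu.-integrable [set: R] (EFin \o (fun x => normc (cutoff E h x) ^+ 2)).
Proof.
move=> mE mh h2; apply: (integrable_dominated _ h2).
  apply: measurable_funX; apply: cmeasurable_normc.
  exact: cmeasurable_cutoff.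
move=> x; rewrite normc_cutoff ger0_norm ?sqr_ge0// indicE exprMn.
by case: (x \in E); rewrite ?expr1n ?mul1r// expr0n mul0r sqr_ge0.
Qed.

(** [|z| <= 1 + |z|^2], and constants are integrable on sets of finite measure. *)
Lemma cutoff_integrable E h : measurable E -> (mu E < +oo)%E -> cmeasurable h ->
  mu.-integrable [set: R] (EFin \o (fun x => normc (h x) ^+ 2)) ->
  cintegrable (cutoff E h).
Proof.
move=> mE Efin mh h2.
apply: (@cintegrable_le _ _ (fun x => \1_E x + normc (h x) ^+ 2)).
- exact: cmeasurable_cutoff.
- have i1 : mu.-integrable [set: R] (EFin \o (\1_E : R -> R)).
    apply/integrableP; split; first by apply/measurable_EFinP; exact: measurable_indic.
    under eq_integral do rewrite /= ger0_norm//.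
    by rewrite integral_indic// setIT.
  exact: (integrableD measurableT i1 h2).
move=> x; rewrite normc_cutoff indicE; case: (x \in E) => /=.
  by rewrite mul1r; have := sqr_ge0 (normc (h x) - 1); have := normc_ge0 (h x); nra.
by rewrite mul0r add0r sqr_ge0.
Qed.

Lemma in_cLfun2_sqr_integrable h : in_cLfun 2%:E h ->
  mu.-integrable [set: R] (EFin \o (fun x => normc (h x) ^+ 2)).
Proof.
move=> [h1 h2]; rewrite /cLnorm unlock => /lty_poweRy hfin.
have mh : measurable_fun [set: R] (fun x => normc (h x) ^+ 2).
  by apply: measurable_funX; apply: cmeasurable_normc.
apply/integrableP; split; first exact/measurable_EFinP.
apply: le_lt_trans (hfin _); last by rewrite invr_eq0.
rewrite le_eqVlt; apply/orP; left; apply/eqP; apply: eq_integral => x _.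
by rewrite /= powR_mulrn // !ger0_norm ?sqr_ge0 ?normc_ge0.
Qed.

Lemma split_normE (m : nat) t h : split_norm ((2 * m)%:R)%:E t h =
  ((\int[mu]_y (normc (fourier (split_shift t h) y) ^+ (2 * m))%:E) `^
    ((2 * m)%:R)^-1)%E.
Proof.
rewrite /split_norm /cLnorm unlock; congr (_ `^ _)%E; apply: eq_integral => y _.
by rewrite /= powR_mulrn// ger0_norm ?normc_ge0.
Qed.

(** Translation of a function becomes modulation of its transform. *)
Lemma fourier_split_shift t h y : cmeasurable h ->
  cintegrable (pos_part h) -> cintegrable (neg_part h) ->
  fourier (split_shift t h) y =
  expi (- (2 * pi * t * y)) * fourier (pos_part h) y +
  expi (- (2 * pi * (- t) * y)) * fourier (neg_part h) y.
Proof.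
move=> mh ip ineg.
have shift_int c s : cintegrable c -> cintegrable (fun x => c (x + s)).
  move=> ic.
  have mc : cmeasurable (fun x : R => c (x + s)).
    apply: (cmeasurable_comp (u := c)); first exact: cintegrable_cmeasurable.
    exact: measurable_funD.
  apply: (@cintegrable_le _ _ (fun x : R => normc (c (x + s)))) => //.
  apply/integrableP; split; first exact/measurable_EFinP/cmeasurable_normc.
  move/integrableP : (cintegrable_normc ic) => [mnc]; apply: le_lt_trans.
  have := @integral_measure_preserving R (fun x => x + s)
    (fun x => `|(normc (c x))%:E|%E) _ (lebesgue_measure_shift s) _.
  by move=> -> //; [exact: measurable_funD|exact: measurableT_comp].
rewrite fourierD; [|exact: shift_int|exact: shift_int].
by rewrite !fourier_shift// !mulrN !mulNr opprK.
Qed.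

End Reduction.

Theorem theorem1p2 (R : realType) (p : nat) (A : R) (f g : R -> R)
    (h : R -> R[i]) :
  (2 <= p)%N -> ~~ odd p -> 0 < A ->
  (forall x, h x = f x +i* g x) ->
  in_cLfun 2%:E h ->
  supported_on `[- A, A] h ->
  let t0 : R := (p%:R - 2) * A / 4 in
  forall t : R, t0 <= t ->
    split_norm (p%:R)%:E t h = split_norm (p%:R)%:E t0 h.
Proof.
move=> p2 p_even A0 _ h2 hA t0 t t0t.
have mh : cmeasurable h by case: h2.
have ih2 := in_cLfun2_sqr_integrable h2.
pose hp := cutoff `]0, A] h; pose hm := cutoff `[- A, 0[ h.
have ihp : cintegrable hp.
  apply: cutoff_integrable => //.
  by rewrite lebesgue_measure_itv /= lte_fin A0 -EFinB ltry.
have ihm : cintegrable hm.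
  apply: cutoff_integrable => //.
  by rewrite lebesgue_measure_itv /= lte_fin oppr_lt0 A0 -EFinB ltry.
have posE : pos_part h = cutoff `]0, +oo[ h.
  apply/funext => x; rewrite /pos_part /cutoff indicE mem_setE in_itv /= andbT.
  by case: (0 < x); rewrite ?mul1r// mul0r.
have negE : neg_part h = cutoff `]-oo, 0[ h.
  apply/funext => x; rewrite /neg_part /cutoff indicE mem_setE in_itv /=.
  by case: (x < 0); rewrite ?mul1r// mul0r.
have mpos : cmeasurable (pos_part h) by rewrite posE; exact: cmeasurable_cutoff.
have mneg : cmeasurable (neg_part h) by rewrite negE; exact: cmeasurable_cutoff.
(* The support condition only holds almost everywhere, while band_fourier wants it
   everywhere: pass to the cutoffs, which have the same transforms. *)
have aep : {ae (@lebesgue_measure R), forall x, pos_part h x = hp x}.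
  apply: filterS hA => [|x hx]; first exact: (ae_filter_ringOfSetsType lebesgue_measure).
  rewrite /pos_part /hp /cutoff indicE mem_setE in_itv /=.
  case: ltP => x0 /=; last by rewrite mul0r.
  case: leP => xA /=; rewrite ?mul1r// hx ?mulr0// => /=.
  by rewrite in_itv /= => /andP[_]; rewrite leNgt xA.
have aem : {ae (@lebesgue_measure R), forall x, neg_part h x = hm x}.
  apply: filterS hA => [|x hx]; first exact: (ae_filter_ringOfSetsType lebesgue_measure).
  rewrite /neg_part /hm /cutoff indicE mem_setE in_itv /= andbC.
  case: ltP => x0 /=; last by rewrite mul0r.
  case: leP => xA /=; rewrite ?mul1r// hx ?mulr0// => /=.
  by rewrite in_itv /= => /andP[]; rewrite leNgt xA.
have ipos : cintegrable (pos_part h) := ae_cintegrable mpos aep ihp.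
have ineg : cintegrable (neg_part h) := ae_cintegrable mneg aem ihm.
have FE s y : fourier (split_shift s h) y = two_bands (fourier hp) (fourier hm) s y.
  rewrite fourier_split_shift//.
  congr (_ * _ + _ * _); apply: ae_cintegral; try exact: cmeasurable_twist;
    try (apply: cmeasurable_twist; exact: cintegrable_cmeasurable).
    by apply: filterS aep => [|x ->//]; exact: (ae_filter_ringOfSetsType lebesgue_measure).
  by apply: filterS aem => [|x ->//]; exact: (ae_filter_ringOfSetsType lebesgue_measure).
have pE : p = (2 * p./2)%N by rewrite mul2n even_halfK.
have m0 : (0 < p./2)%N by rewrite half_gt0.
have t0E : t0 = ((p./2)%:R - 1) * A / 2.
  by rewrite /t0 [in LHS]pE natrM; field.
suff energyE : (\int[mu]_y (normc (two_bands (fourier hp) (fourier hm) t y) ^+ (2 * p./2))%:E =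
    \int[mu]_y (normc (two_bands (fourier hp) (fourier hm) t0 y) ^+ (2 * p./2))%:E)%E.
  have split_energy s : split_norm p%:R%:E s h =
      ((\int[mu]_y (normc (two_bands (fourier hp) (fourier hm) s y) ^+ (2 * p./2))%:E)
        `^ ((2 * p./2)%:R)^-1)%E.
    rewrite [in LHS]pE split_normE.
    by under eq_integral do rewrite FE.
  by rewrite (split_energy t) (split_energy t0) energyE.
rewrite t0E; apply: (@two_bands_energy _ A) => //.
- apply: band_fourier => // x; rewrite /hp /cutoff indicE mem_setE in_itv /=.
  by case: ltP => //= x0; [rewrite (ltW x0) /= => /negbTE ->|]; rewrite mul0r.
- apply: band_fourier => // x; rewrite /hm /cutoff indicE mem_setE in_itv /=.
  by case: ltP => //= x0; [rewrite (ltW x0) andbT => /negbTE ->|rewrite andbF]; rewrite mul0r.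
- by apply: integrable_fourier_sqr => //; exact: cutoff_sqr_integrable.
- by apply: integrable_fourier_sqr => //; exact: cutoff_sqr_integrable.
- by rewrite -t0E.
Qed.
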